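(* Let $-\infty<a<b<+\infty$, $0<\alpha<1$, $0\le\beta\le1$, $\gamma=\alpha+\beta-\alpha\beta$, and let $c,d,e_k\in\mathbb{R}$. Assume that $f:(a,b]\times\mathbb{R}\to\mathbb{R}$ is a function such that $f(\cdot,z(\cdot))\in C_{1-\gamma}^{\beta(1-\alpha)}[a,b]$ for any $z\in C_{1-\gamma}[a,b]$, and that there exists a function $\eta\in C_{1-\gamma}[a,b]$ such that $$|f(t,z)|\le\eta(t)\quad\text{for all }t\in(a,b],\ z\in\mathbb{R}.$$ Then the Hilfer boundary value problem $$D_{a^+}^{\alpha,\beta}z(t)=f(t,z(t)),\quad t\in(a,b],\qquad I_{a^+}^{1-\gamma}\big[c\,z(a^+)+d\,z(b^-)\big]=e_k,$$ has at least one solution $z$ in $C_{1-\gamma}^{\gamma}[a,b]\subset C_{1-\gamma}^{\alpha,\beta}[a,b]$.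
   Context: Notation. For $\mu>0$, $I_{a^+}^{\mu}g(t)=\frac1{\Gamma(\mu)}\int_a^t(t-s)^{\mu-1}g(s)\,ds$ is the left-sided Riemann–Liouville fractional integral ($\Gamma$ is Euler's Gamma function), and $I_{a^+}^0$ is the identity. For $0\le\mu\le1$, $D_{a^+}^{\mu}g=\frac{d}{dt}I_{a^+}^{1-\mu}g$ is the Riemann–Liouville derivative. For $0<\alpha<1$, $0\le\beta\le1$, the Hilfer derivative of order $\alpha$ and type $\beta$ is $D_{a^+}^{\alpha,\beta}g=I_{a^+}^{\beta(1-\alpha)}\frac{d}{dt}I_{a^+}^{(1-\beta)(1-\alpha)}g$. With $\gamma=\alpha+\beta-\alpha\beta$ one has $(1-\beta)(1-\alpha)=1-\gamma$. Spaces. $C_{1-\gamma}[a,b]$ is the set of $g:(a,b]\to\mathbb{R}$ such that $(t-a)^{1-\gamma}g(t)$ is continuous on $[a,b]$ (i.e. extends continuously to $t=a$), with norm $\|g\|_{C_{1-\gamma}}=\sup_{t\in(a,b]}|(t-a)^{1-\gamma}g(t)|$. For $0\le\mu\le1$, $C_{1-\gamma}^{\mu}[a,b]=\{g\in C_{1-\gamma}[a,b]: D_{a^+}^{\mu}g\in C_{1-\gamma}[a,b]\}$ (used with $\mu=\gamma$ and $\mu=\beta(1-\alpha)$). $C_{1-\gamma}^{\alpha,\beta}[a,b]=\{g\in C_{1-\gamma}[a,b]: D_{a^+}^{\alpha,\beta}g\in C_{1-\gamma}[a,b]\}$. The boundary condition $I_{a^+}^{1-\gamma}[c\,z(a^+)+d\,z(b^-)]=e_k$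 means $c\lim_{t\to a^+}I_{a^+}^{1-\gamma}z(t)+d\lim_{t\to b^-}I_{a^+}^{1-\gamma}z(t)=e_k$. Here $e_k$ is just a fixed real number.
   Formalization: The formal theorem adds the assumption c + d ≠ 0, without which the claim is false: for f = 0, η = 0, c = 1, d = −1, e_k = 1 the boundary condition reads 0 = 1. *)

(* Defs.v *)
From mathcomp Require Import all_boot all_order all_algebra.
From mathcomp Require Import all_classical all_reals all_analysis.
Set Implicit Arguments.
Unset Strict Implicit.
Unset Printing Implicit Defensive.
Import Order.TTheory GRing.Theory Num.Theory.
Import numFieldNormedType.Exports.
Local Open Scope classical_set_scope.
Local Open Scope ring_scope.

(* A function on (a, b] is represented by a total function R -> R; every notion
   below depends only on its values on (a, b]. *)

Definition Gamma (R : realType) (mu : R) : R :=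
  \int[lebesgue_measure]_(x in `]0, +oo[) (x `^ (mu - 1) * expR (- x)).

Definition RL_kernel (R : realType) (mu : R) (g : R -> R) (t s : R) : R :=
  (t - s) `^ (mu - 1) * g s.

(* Left-sided Riemann-Liouville integral (a Lebesgue integral, which equals the
   improper Riemann integral for weighted-continuous g); the identity for
   mu = 0. *)
Definition RL_int (R : realType) (a mu : R) (g : R -> R) (t : R) : R :=
  if mu == 0 then g t
  else (Gamma mu)^-1 *
       \int[lebesgue_measure]_(s in `]a, t[) RL_kernel mu g t s.

(* The integral defining RL_int a mu g t converges absolutely. *)
Definition RL_integrable (R : realType) (a mu : R) (g : R -> R) (t : R) : Prop :=
  mu = 0 \/
  lebesgue_measure.-integrable `]a, t[ (fun s : R => (RL_kernel mu g t s)%:E).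

(* Difference quotients of g at t, taken along points of (a, b] only: the
   derivative is the usual one for a < t < b and the left one at t = b. *)
Definition diff_quot (R : realType) (a b : R) (g : R -> R) (t : R) :
    set_system R :=
  (g s - g t) / (s - t) @[s --> within `]a, b] t^'].

Definition differentiable_at (R : realType) (a b : R) (g : R -> R) (t : R) :
    Prop :=
  cvg (diff_quot a b g t).

Definition ddt (R : realType) (a b : R) (g : R -> R) (t : R) : R :=
  lim (diff_quot a b g t).

Definition RL_deriv (R : realType) (a b mu : R) (g : R -> R) : R -> R :=
  ddt a b (RL_int a (1 - mu) g).

Definition hilfer_deriv (R : realType) (a b alpha beta : R) (g : R -> R) :
    R -> R :=
  RL_int a (beta * (1 - alpha))
    (ddt a b (RL_int a ((1 - beta) * (1 - alpha)) g)).

(* ddt and RL_int are total functions with default values, so the existence of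
   the derivatives and integrals is stated separately. *)
Definition RL_deriv_exists (R : realType) (a b mu : R) (g : R -> R) : Prop :=
  forall t : R, t \in `]a, b] ->
    differentiable_at a b (RL_int a (1 - mu) g) t.

Definition hilfer_deriv_exists (R : realType) (a b alpha beta : R)
    (g : R -> R) : Prop :=
  forall t : R, t \in `]a, b] ->
    differentiable_at a b (RL_int a ((1 - beta) * (1 - alpha)) g) t /\
    RL_integrable a (beta * (1 - alpha))
      (ddt a b (RL_int a ((1 - beta) * (1 - alpha)) g)) t.

(* As in C_{1-gamma}[a, b], the weight is (t - a)^(1 - gamma), not
   (t - a)^gamma; h is the continuous extension to t = a. *)
Definition C_weighted (R : realType) (a b gamma : R) : set (R -> R) :=
  [set g | exists h : R -> R,
    {within `[a, b], continuous h} /\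
    forall t : R, t \in `]a, b] -> h t = (t - a) `^ (1 - gamma) * g t].

Definition C_RL (R : realType) (a b gamma mu : R) : set (R -> R) :=
  [set g | [/\ C_weighted a b gamma g,
               RL_deriv_exists a b mu g &
               C_weighted a b gamma (RL_deriv a b mu g)]].

Definition C_hilfer (R : realType) (a b gamma alpha beta : R) : set (R -> R) :=
  [set g | [/\ C_weighted a b gamma g,
               hilfer_deriv_exists a b alpha beta g &
               C_weighted a b gamma (hilfer_deriv a b alpha beta g)]].

(* I_{a+}^{1-gamma}[c z(a+) + d z(b-)] = e *)
Definition boundary_condition (R : realType) (a b gamma c d e : R)
    (z : R -> R) : Prop :=
  exists la lb : R,
    [/\ RL_int a (1 - gamma) z t @[t --> a^'+] --> la,
        RL_int a (1 - gamma) z t @[t --> b^'-] --> lb &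
        c * la + d * lb = e].

(* Main.v *)
(* No infinite-dimensional fixed point theorem is used.  Writing mu for
   beta (1 - alpha), a solution is
   z = K (t - a)^(gamma - 1) + I^alpha f(., z), with K determined by the boundary
   condition.  In the weighted unknown w = (t - a)^(1 - gamma) z, delaying the
   integral term by 1/n (Tonelli) yields an equation that is solved by finitely
   many iterations for every K, with a solution depending continuously on K; as
   f is dominated by eta, the intermediate value theorem provides a K_n for which
   the boundary condition holds.  The domination also makes the integral terms
   equicontinuous, so that w_n converges uniformly along an ultrafilter, hence
   along a subsequence, and dominated convergence passes to the limit.  This
   needs f(t, .) to be continuous, which is forced by the continuity of
   f(., zeta(.)) for all continuous zeta.  Finally D^(alpha, beta) z = I^mu D^mu F
   for F = f(., z), which is F because I^(1 - mu) F vanishes at a. *)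

From HB Require Import structures.
Require Import Defs.
From mathcomp Require Import all_boot all_order all_algebra.
From mathcomp Require Import all_classical all_reals all_analysis.
From mathcomp Require Import measurable_realfun.
From mathcomp Require Import ring lra zify.
Import Order.TTheory GRing.Theory Num.Theory.
Import numFieldNormedType.Exports.
Local Open Scope classical_set_scope.
Local Open Scope ring_scope.
Set Implicit Arguments.
Unset Strict Implicit.
Unset Printing Implicit Defensive.

(** * Riemann-Liouville kernels and the Gamma function *)

(** The obstacle is non-uniqueness. As [f] is not assumed Lipschitz, the undelayed equation with a
    given K may have many solutions, so there is no continuous map from K to the boundary value to
    which the intermediate value theorem could be applied. Nor is K known in advance: the boundary
    condition reads (c + d) K Gamma(gamma) + d I^(1 - mu) F(b) = e, which involves the solution
    through F. The delay makes the solution a single-valued function of K, and the bounds from [eta]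
    are the same for all w, hence for all delays, so that the K_n stay bounded. The orders fit
    together because gamma = alpha + mu: I^(1 - gamma) turns I^alpha F into I^(1 - mu) F. All orders
    of integration are at most 1, so Gamma is shown to be finite on (0, 1] only, and the semigroup
    law is used up to total order 1. *)

Lemma lebesgue_measure_affine (R : realType) (l c : R) (A : set R) :
  0 < l -> measurable A ->
  (l%:E * pushforward (@lebesgue_measure R)
    ((fun x => l * x + c)%R : _ -> measurableTypeR R) A =
  lebesgue_measure A)%E.
Proof.
move=> l0 mA.
pose f : measurableTypeR R -> measurableTypeR R := fun x : R => l * x + c.
have mphi : measurable_fun setT f.
  by apply: measurable_funD => //; apply: measurable_funM.
pose m := mscale (NngNum (ltW l0)) (pushforward (@lebesgue_measure R) f).
transitivity (m mphi A); first by [].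
apply/esym/lebesgue_measure_unique => //= _ [[a b]] _ <-.
rewrite /mscale /= /pushforward /=.
have -> : (fun x => l * x + c) @^-1` `]a, b] =
    `](a - c) / l, (b - c) / l]%classic.
  apply/seteqP; split => x /=; rewrite !in_itv/= ltr_pdivrMr// ler_pdivlMr//;
    by rewrite ltrBlDr lerBrDr mulrC.
rewrite !lebesgue_measure_itv/= !lte_fin ltr_pM2r ?invr_gt0// ltrD2r.
case: ifPn => _; last by rewrite mule0.
rewrite -!EFinB -EFinM; congr EFin; field.
by rewrite gt_eqF.
Qed.

(** Lebesgue measure is [l] times its pushforward under x |-> l x + c. Values in [0, +oo] are
    allowed, so the formula applies to Beta and Gamma integrals before they are known to be
    finite. *)
Lemma ge0_integral_affine (R : realType) (l c : R) (f : R -> \bar R) :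
  0 < l -> measurable_fun setT f -> (forall x, (0 <= f x)%E) ->
  (\int[lebesgue_measure]_x f x =
   l%:E * \int[lebesgue_measure]_x f (l * x + c)%R)%E.
Proof.
move=> l0 mf f0.
pose g : measurableTypeR R -> measurableTypeR R := fun x : R => l * x + c.
have mphi : measurable_fun setT g.
  by apply: measurable_funD => //; apply: measurable_funM.
pose m := mscale (NngNum (ltW l0)) (pushforward (@lebesgue_measure R) g).
transitivity (\int[m mphi]_x f x)%E.
  by apply: eq_measure_integral => /= A mA _; rewrite -(lebesgue_measure_affine c l0 mA).
rewrite ge0_integral_mscale//=; congr (_ * _)%E.
by rewrite ge0_integral_pushforward.
Qed.

Lemma ge0_integral_shift (R : realType) (c : R) (f : R -> \bar R) :
  measurable_fun setT f -> (forall x, (0 <= f x)%E) ->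
  (\int[lebesgue_measure]_x f (x + c)%R = \int[lebesgue_measure]_x f x)%E.
Proof.
move=> mf f0; rewrite [RHS](ge0_integral_affine c ltr01 mf f0) mul1e.
by apply: eq_integral => x _; rewrite mul1r.
Qed.

(* [x_+^(m-1)]; the cutoff matters since [powR] is 1 at negative arguments *)
Definition ker (R : realType) (m x : R) : R := if 0 < x then x `^ (m - 1) else 0.

Lemma ker_ge0 (R : realType) (m x : R) : 0 <= ker m x.
Proof. by rewrite /ker; case: ifPn => // _; exact: powR_ge0. Qed.

Lemma ker_pos (R : realType) (m x : R) : 0 < x -> ker m x = x `^ (m - 1).
Proof. by rewrite /ker => ->. Qed.

Lemma ker_npos (R : realType) (m x : R) : x <= 0 -> ker m x = 0.
Proof. by rewrite /ker leNgt => /negbTE ->. Qed.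

Lemma measurable_ker (R : realType) (m : R) : measurable_fun setT (@ker R m).
Proof.
rewrite /ker; apply: measurable_fun_ifT.
- exact: measurable_fun_ltr.
- exact: measurable_powR.
- exact: measurable_cst.
Qed.

Lemma measurable_ker_comp d (T : measurableType d) (R : realType) (m : R)
    (f : T -> R) :
  measurable_fun setT f -> measurable_fun setT (fun x => ker m (f x)).
Proof. by move=> mf; exact: (measurableT_comp (measurable_ker m) mf). Qed.

Lemma kerZ (R : realType) (m l x : R) : 0 < l ->
  ker m (l * x) = l `^ (m - 1) * ker m x.
Proof.
move=> l0; rewrite /ker pmulr_rgt0//; case: ifPn => x0; last by rewrite mulr0.
by rewrite powRM// ltW.
Qed.

(** Euler's Beta integral B(m, n): the cutoffs in [ker] confine y to (0, 1). It is kept in [0, +oo]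
    so that Tonelli's theorem can be used before finiteness is known. *)
Definition eBeta (R : realType) (m n : R) : \bar R :=
  (\int[lebesgue_measure]_y (ker m (1 - y) * ker n y)%:E)%E.

Lemma measurable_conv_ker (R : realType) (m n x : R) :
  measurable_fun setT (fun y : R => (ker m (x - y) * ker n y)%:E).
Proof.
apply/measurable_EFinP; apply: measurable_funM; last exact: measurable_ker.
by apply: measurable_ker_comp; exact: measurable_funB.
Qed.

(** Substituting x u for y, the factor x from the measure and the powers x^(m - 1) and x^(n - 1)
    combine to x^(m + n - 1). For x <= 0 both sides are 0, by 0 * +oo = 0 if the Beta integral
    diverges. *)
Lemma conv_ker (R : realType) (m n x : R) :
  (\int[lebesgue_measure]_y (ker m (x - y) * ker n y)%:E =
   (ker (m + n) x)%:E * eBeta m n)%E.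
Proof.
have [x0|x0] := ltP 0 x; last first.
  rewrite [ker (m + n) x]ker_npos// mul0e integral0_eq// => y _.
  have [y0|y0] := ltP 0 y; last by rewrite [ker n y]ker_npos// mulr0.
  by rewrite ker_npos ?mul0r// subr_le0 (le_trans x0)// ltW.
rewrite (ge0_integral_affine 0 x0 (measurable_conv_ker m n x)); last first.
  by move=> y; rewrite lee_fin mulr_ge0// ker_ge0.
under eq_integral.
  move=> y _; rewrite addr0 -[X in X - _]mulr1 -mulrBr !kerZ//.
  rewrite mulrACA EFinM; over.
rewrite ge0_integralZl//=; last 3 first.
- exact: (measurable_conv_ker m n 1).
- by move=> y _; rewrite lee_fin mulr_ge0// ker_ge0.
- by rewrite lee_fin mulr_ge0// powR_ge0.
rewrite muleA -EFinM; congr (_%:E * _)%E; rewrite ker_pos//.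
rewrite -{1}(powRr1 (ltW x0)) -!powRD ?(gt_eqF x0) ?implybT//.
by congr (_ `^ _); lra.
Qed.

Definition eGamma (R : realType) (m : R) : \bar R :=
  (\int[lebesgue_measure]_x (ker m x * expR (- x))%:E)%E.

Lemma measurable_Gamma_integrand (R : realType) (m : R) :
  measurable_fun setT (fun x : R => (ker m x * expR (- x))%:E).
Proof.
apply/measurable_EFinP; apply: measurable_funM; first exact: measurable_ker.
by apply: measurableT_comp => //; exact: measurable_expR.
Qed.

Lemma GammaE (R : realType) (m : R) : Gamma m = fine (eGamma m).
Proof.
rewrite /Gamma Rintegral_mkcond; congr fine.
apply: eq_integral => x _; congr EFin.
rewrite patchE /ker; case: ifPn => [|/negP]; rewrite inE/= in_itv/= andbT.
  by move=> ->.
by move/negP/negbTE => ->; rewrite mul0r.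
Qed.

(** The product is a double integral of x^(m - 1) y^(n - 1) e^(- x - y); replacing x by u - y and
    exchanging the integrals leaves a convolution of kernels inside. Being an identity in [0, +oo],
    it lets finiteness of Beta follow from that of Gamma. *)
Lemma eGamma_eBeta (R : realType) (m n : R) :
  (eGamma m * eGamma n = eBeta m n * eGamma (m + n))%E.
Proof.
have k0 (p x : R) : 0 <= ker p x * expR (- x) by rewrite mulr_ge0 ?ker_ge0 ?expR_ge0.
pose h (z : R * R) := (ker m (z.2 - z.1) * ker n z.1 * expR (- z.2))%:E.
have mh : measurable_fun setT h.
  apply/measurable_EFinP; apply: measurable_funM; first apply: measurable_funM.
  - by apply: measurable_ker_comp; apply: measurable_funB.
  - exact: measurable_ker_comp.
  - by apply: measurableT_comp => //; apply: measurableT_comp.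
have h0 z : (0 <= h z)%E.
  by rewrite lee_fin !mulr_ge0 ?ker_ge0 ?expR_ge0.
transitivity (\int[lebesgue_measure]_y \int[lebesgue_measure]_u h (y, u))%E.
  rewrite muleC /eGamma -ge0_integralZr//=; last 3 first.
  - exact: measurable_Gamma_integrand.
  - by move=> x _; rewrite lee_fin k0.
  - by apply: integral_ge0 => x _; rewrite lee_fin k0.
  apply: eq_integral => y _.
  rewrite -(ge0_integral_shift (- y) (measurable_Gamma_integrand m)); last first.
    by move=> x; rewrite lee_fin k0.
  rewrite -ge0_integralZl//=; last 3 first.
  - apply: (measurableT_comp (measurable_Gamma_integrand m)).
    exact: measurable_funD.
  - by move=> x _; rewrite lee_fin k0.
  - by rewrite lee_fin k0.
  apply: eq_integral => u _; rewrite -EFinM /h/=; congr EFin.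
  have -> : expR (- u) = expR (- y) * expR (y - u).
    by rewrite -expRD; congr expR; ring.
  by rewrite opprB; ring.
rewrite fubini_tonelli//; transitivity (\int[lebesgue_measure]_u
    (eBeta m n * (ker (m + n) u * expR (- u))%:E))%E.
  apply: eq_integral => u _; rewrite /h/=.
  under eq_integral do rewrite EFinM.
  rewrite ge0_integralZr//=; last 2 first.
  - exact: measurable_conv_ker.
  - by move=> x _; rewrite lee_fin mulr_ge0 ?ker_ge0.
  by rewrite conv_ker EFinM muleCA muleA.
rewrite ge0_integralZl//=.
- exact: measurable_Gamma_integrand.
- by move=> x _; rewrite lee_fin k0.
- by apply: integral_ge0 => x _; rewrite lee_fin mulr_ge0 ?ker_ge0.
Qed.

Lemma ge0_integral_gt0 (R : realType) (D : set R) (f : R -> R) (x y c : R) :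
  x < y -> 0 < c -> `]x, y[ `<=` D -> measurable D -> measurable_fun D f ->
  (forall t, D t -> 0 <= f t) -> (forall t, t \in `]x, y[ -> c <= f t) ->
  (0 < \int[lebesgue_measure]_(t in D) (f t)%:E)%E.
Proof.
move=> xy c0 sD mD mf f0 cf.
apply: (@lt_le_trans _ _ (\int[lebesgue_measure]_(t in `]x, y[) c%:E)%E).
  rewrite integral_cst//= lebesgue_measure_itv/= lte_fin xy -EFinB -EFinM lte_fin.
  by rewrite mulr_gt0// subr_gt0.
apply: (@le_trans _ _ (\int[lebesgue_measure]_(t in `]x, y[) (f t)%:E)%E).
  apply: ge0_le_integral => //=.
  - by move=> t _; rewrite lee_fin ltW.
  - by apply/measurable_EFinP; exact: (measurable_funS mD sD mf).
by apply: ge0_subset_integral => //=; exact/measurable_EFinP.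
Qed.

Lemma eGamma_gt0 (R : realType) (m : R) : (0 < eGamma m)%E.
Proof.
(* A lower bound of the integrand on (1, 2): t^(m - 1) is monotone, so it is at least the smaller of
   its endpoint values. *)
pose c := Num.min 1 (2 `^ (m - 1)) * expR (- 2) : R.
apply: (@ge0_integral_gt0 R setT _ 1 2 c) => //.
- lra.
- by rewrite mulr_gt0 ?expR_gt0// lt_min ltr01 powR_gt0.
- by have /measurable_EFinP := measurable_Gamma_integrand m.
- by move=> t _; rewrite mulr_ge0 ?ker_ge0 ?expR_ge0.
move=> t; rewrite in_itv/= => /andP[t1 t2].
rewrite ker_pos; last lra.
apply: ler_pM.
- by rewrite le_min ler01 powR_ge0.
- exact: expR_ge0.
- have [m1|m1] := leP 1 m.
    rewrite ge_min; apply/orP; left; rewrite -[leLHS](powRr0 t) ler_powR//; lra.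
  rewrite ge_min; apply/orP; right; rewrite /powR !gt_eqF//; [|lra..].
  rewrite ler_expR ler_wnM2l ?ler_ln ?posrE//; lra.
- rewrite ler_expR; lra.
Qed.

(** The singularity at 0 is approached through the intervals [1 / (n + 2), 1], nondegenerate also
    for n = 0, on which the fundamental theorem applies to x^m / m. *)
Lemma integral_ker01 (R : realType) (m : R) : 0 < m ->
  (\int[lebesgue_measure]_(x in `]0%R, 1%R]) (ker m x)%:E <= m^-1%:E)%E.
Proof.
move=> m0; pose F n := `[n.+2%:R^-1, 1 : R]%classic.
have F0 n : 0 < n.+2%:R^-1 :> R by rewrite invr_gt0 ltr0n.
have ndF : nondecreasing_seq F.
  move=> p q pq; apply/subsetPset => x; rewrite /F/= !in_itv/= => /andP[px ->].
  rewrite andbT (le_trans _ px)// lef_pV2 ?posrE ?ltr0n// ler_nat; lia.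
have UF : `]0, 1]%classic = \bigcup_n F n.
  apply/seteqP; split => x.
    rewrite /= in_itv/= => /andP[x0 x1].
    exists (Num.truncn x^-1) => //; rewrite /F/= in_itv/= x1 andbT.
    rewrite -[leRHS]invrK lef_pV2 ?posrE ?invr_gt0 ?ltr0n//.
    have /andP[_ /ltW/le_trans] := truncn_itv (ltW (etrans (invr_gt0 x) x0)).
    by apply; rewrite ler_nat.
  move=> [n _]; rewrite /F/= !in_itv/= => /andP[nx ->].
  by rewrite andbT (lt_le_trans _ nx).
have mF n : measurable (F n) by exact: measurable_itv.
have mk A : measurable_fun A (fun x => (ker m x)%:E).
  by apply/measurable_EFinP; apply: measurable_funTS; exact: measurable_ker.
have : (\int[lebesgue_measure]_(x in F i) (ker m x)%:E @[i --> \oo] -->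
    \int[lebesgue_measure]_(x in \bigcup_i F i) (ker m x)%:E)%E.
  apply: ge0_nondecreasing_set_cvg_integral => //.
    by move=> i; exact: mk.
  by move=> i x _; rewrite lee_fin ker_ge0.
rewrite -UF => /cvg_lim <-//; apply: lime_le.
  apply: ereal_nondecreasing_is_cvgn.
  apply: ge0_nondecreasing_set_nondecreasing_integral => //.
    by move=> i; exact: mk.
  by move=> i x _; rewrite lee_fin ker_ge0.
apply: nearW => n.
pose G := fun x : R => m^-1 * x `^ m.
have n1 : n.+2%:R^-1 < 1 :> R by rewrite invf_lt1 ?ltr0n// ltr1n.
have dG (x : R) : 0 < x -> is_derive x 1 G (x `^ (m - 1)).
  move=> x0; have -> : x `^ (m - 1) = m^-1 *: (m * x `^ (m - 1)).
    by rewrite /GRing.scale/= mulKf// gt_eqF.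
  by apply: is_deriveZ; exact: is_derive1_powR.
have cG (x : R) : 0 < x -> {for x, continuous G}.
  by move=> /dG dGx; apply/differentiable_continuous/derivable1_diffP.
have -> : (\int[lebesgue_measure]_(x in F n) (ker m x)%:E =
    \int[lebesgue_measure]_(x in F n) (x `^ (m - 1))%:E)%E.
  apply: eq_integral => x; rewrite inE /F/= in_itv/= => /andP[nx _]; rewrite ker_pos//.
  exact: lt_le_trans nx.
rewrite (@continuous_FTC2 _ _ G)//.
- rewrite /G powR1 mulr1 -EFinB lee_fin lerBlDr lerDl mulr_ge0 ?powR_ge0//.
  by rewrite invr_ge0 ltW.
- apply: continuous_in_subspaceT => x; rewrite inE/= in_itv/= => /andP[nx _].
  have x0 := lt_le_trans (F0 n) nx.
  apply/differentiable_continuous/derivable1_diffP/derivable_powR.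
  by rewrite in_itv/= x0.
- split.
  + move=> x; rewrite in_itv/= => /andP[nx _].
    by have := dG _ (lt_trans (F0 n) nx).
  + exact/cvg_at_right_filter/cG.
  + exact/cvg_at_left_filter/cG.
- move=> x; rewrite in_itv/= => /andP[nx _].
  by have := dG _ (lt_trans (F0 n) nx) => dx; rewrite derive1E derive_val.
Qed.

(** On (0, 1] the exponential is at most 1; beyond 1 the power x^(m - 1) is at most 1 because m <=
    1, which leaves the exponential density. *)
Lemma eGamma_lty (R : realType) (m : R) : 0 < m <= 1 -> (eGamma m < +oo)%E.
Proof.
move=> /andP[m0 m1].
pose g (x : R) : \bar R := (((ker m) \_ `]0, 1]) x)%:E.
pose p (x : R) : \bar R := (exponential_pdf 1 x)%:E.
have mg : measurable_fun setT g.
  apply/measurable_EFinP/(measurable_restrictT _ _).1 => //.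
  by apply: measurable_funTS; exact: measurable_ker.
have mp : measurable_fun setT p 
  by apply/measurable_EFinP; exact: measurable_exponential_pdf.
have g0 x : (0 <= g x)%E.
  by rewrite lee_fin; apply: restrict_ge0 => y _; exact: ker_ge0.
have pE (x : R) : 0 <= x -> p x = (expR (- x))%:E.
  by move=> x0; rewrite /p exponential_pdfE// mul1r mulN1r.
have p0 x : (0 <= p x)%E by rewrite lee_fin exponential_pdf_ge0.
apply: (@le_lt_trans _ _ (\int[lebesgue_measure]_x (g x + p x))%E).
  apply: ge0_le_integral => //=.
  - by move=> x _; rewrite lee_fin mulr_ge0 ?ker_ge0 ?expR_ge0.
  - exact: measurable_Gamma_integrand.
  - exact: emeasurable_funD.
  move=> x _; have [x0|x0] := leP x 0.
    by rewrite ker_npos// mul0r adde_ge0.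
  have [x1|x1] := leP x 1.
    apply: le_trans (leeDl _ (p0 x)).
    rewrite /g patchE ifT ?inE/= ?in_itv/= ?x0// lee_fin ler_piMr ?ker_ge0//.
    by rewrite -expR0 ler_expR oppr_le0 ltW.
  apply: le_trans (leeDr _ (g0 x)).
  rewrite (pE _ (ltW x0)) lee_fin ler_piMl ?expR_ge0//.
  rewrite ker_pos// -[leRHS](powRr0 x) ler_powR ?(ltW x1)//; lra.
rewrite ge0_integralD//= /p integral_exponential_pdf// lte_add_pinfty ?ltry//.
apply: le_lt_trans (ltry m^-1).
by rewrite (le_trans _ (integral_ker01 m0))// [leRHS]integral_mkcond restrict_EFin.
Qed.

Lemma eGamma1 (R : realType) : eGamma 1 = 1%E :> \bar R.
Proof.
pose p (x : R) : \bar R := (exponential_pdf 1 x)%:E.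
have mp : measurable_fun setT p.
  by apply/measurable_EFinP; exact: measurable_exponential_pdf.
have pE (x : R) : 0 <= x -> p x = (expR (- x))%:E.
  by move=> x0; rewrite /p exponential_pdfE// mul1r mulN1r.
rewrite -(@integral_exponential_pdf R 1 ltr01).
transitivity (\int[lebesgue_measure]_(x in `]0%R, +oo[) p x)%E.
  rewrite [RHS]integral_mkcond; apply: eq_integral => x _.
  rewrite patchE; case: ifPn => [|/negP]; rewrite inE/= in_itv/= andbT => x0.
    by rewrite ker_pos// subrr powRr0 mul1r pE// ltW.
  by rewrite ker_npos ?mul0r// leNgt; apply/negP.
rewrite integral_itv_obnd_cbnd; last by apply: measurable_funTS.
rewrite [LHS]integral_mkcond; apply: eq_integral => x _.
rewrite patchE; case: ifPn => // /negP; rewrite inE/= in_itv/= andbT => /negP.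
by rewrite -ltNge => x0; rewrite lt0_exponential_pdf.
Qed.

(** An infinite Beta value would make the right-hand side of [eGamma_eBeta] infinite, since Gamma(m
    + n) is positive; this works also when m + n > 1. *)
Lemma eBeta_lty (R : realType) (m n : R) : 0 < m <= 1 -> 0 < n <= 1 -> (eBeta m n < +oo)%E.
Proof.
move=> m01 n01; have : (eGamma m * eGamma n < +oo)%E.
  by rewrite lte_mul_pinfty ?eGamma_lty// ?ge0_fin_numE ?eGamma_lty// ltW ?eGamma_gt0.
rewrite eGamma_eBeta; apply: contraTT; rewrite -!leNgt !leye_eq => /eqP ->.
by rewrite gt0_mulye ?eGamma_gt0.
Qed.

Lemma eBeta_ge0 (R : realType) (m n : R) : (0 <= eBeta m n)%E.
Proof. by apply: integral_ge0 => x _; rewrite lee_fin mulr_ge0 ?ker_ge0. Qed.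

Lemma eBeta_fin (R : realType) (m n : R) : 0 < m <= 1 -> 0 < n <= 1 ->
  eBeta m n \is a fin_num.
Proof. by move=> m01 n01; rewrite ge0_fin_numE ?eBeta_ge0 ?eBeta_lty. Qed.

Lemma Gamma_gt0 (R : realType) (m : R) : 0 < m <= 1 -> 0 < Gamma m.
Proof. by move=> m01; rewrite GammaE fine_gt0// eGamma_gt0 eGamma_lty. Qed.

Lemma Gamma_eBeta (R : realType) (m n : R) : 0 < m -> 0 < n -> m + n <= 1 ->
  Gamma m * Gamma n = fine (eBeta m n) * Gamma (m + n).
Proof.
move=> m0 n0 mn1.
have Gfin (p : R) : 0 < p <= 1 -> eGamma p \is a fin_num.
  by move=> p01; rewrite ge0_fin_numE ?eGamma_lty// ltW// eGamma_gt0.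
have m01 : 0 < m <= 1 by lra.
have n01 : 0 < n <= 1 by lra.
have mn01 : 0 < m + n <= 1 by lra.
rewrite 3!GammaE -(fineM (Gfin _ m01) (Gfin _ n01)) eGamma_eBeta.
by rewrite (fineM (eBeta_fin m01 n01) (Gfin _ mn01)).
Qed.

Lemma Gamma1 (R : realType) : Gamma 1 = 1 :> R.
Proof. by rewrite GammaE eGamma1. Qed.

Lemma ker_antitone (R : realType) (m x y : R) :
  m <= 1 -> 0 < x <= y -> ker m y <= ker m x.
Proof.
move=> m1 /andP[x0 xy]; have y0 := lt_le_trans x0 xy.
rewrite !ker_pos// -(opprB 1 m) !powRN lef_pV2 ?posrE ?powR_gt0//.
by apply: ge0_ler_powR; rewrite ?nnegrE ?subr_ge0 ?(ltW x0) ?(ltW y0).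
Qed.

(** * Convolution with the kernels *)

(** The integral I^m without the factor 1 / Gamma(m), taken over the whole line: the cutoff in [ker]
    ends it at t, and it starts at a when [phi] vanishes to the left of a. *)
Definition rl_conv (R : realType) (m : R) (phi : R -> R) (t : R) : R :=
  \int[lebesgue_measure]_s (ker m (t - s) * phi s).

(** As the kernel is 0 for s <= a, the bound also forces [phi] to vanish there. The constant M is
    explicit so that the estimates below are uniform over families of functions. *)
Definition wbounded (R : realType) (a g M : R) (phi : R -> R) : Prop :=
  measurable_fun setT phi /\ forall s, `|phi s| <= M * ker g (s - a).

Lemma integral_conv_ker (R : realType) (m n a t : R) :
  (\int[lebesgue_measure]_s (ker m (t - s) * ker n (s - a))%:E =
   (ker (m + n) (t - a))%:E * eBeta m n)%E.
Proof.
rewrite -conv_ker -(ge0_integral_shift (- a) (measurable_conv_ker m n _)).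
  by apply: eq_integral => s _; rewrite /= (_ : t - a - (s - a) = t - s)//; ring.
by move=> x; rewrite lee_fin mulr_ge0 ?ker_ge0.
Qed.

Lemma integrable_conv_ker (R : realType) (m n a t : R) :
  0 < m <= 1 -> 0 < n <= 1 ->
  lebesgue_measure.-integrable setT
    (EFin \o (fun s : R => ker m (t - s) * ker n (s - a))).
Proof.
move=> m01 n01; apply/integrableP; split.
  apply/measurable_EFinP; apply: measurable_funM; apply: measurable_ker_comp.
    exact: measurable_funB.
  exact: measurable_funB.
under eq_integral do rewrite /= ger0_norm ?mulr_ge0 ?ker_ge0//.
by rewrite integral_conv_ker lte_mul_pinfty ?eBeta_lty// lee_fin ker_ge0.
Qed.

Lemma rl_conv_ker (R : realType) (m n a t : R) :
  rl_conv m (fun s => ker n (s - a)) t = fine (eBeta m n) * ker (m + n) (t - a).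
Proof.
rewrite /rl_conv /Rintegral integral_conv_ker.
have [|] := eqVneq (ker (m + n) (t - a)) 0 => [->|k0].
  by rewrite mul0e mulr0.
(* If the Beta integral is +oo, both sides are 0, as [fine] sends +oo to 0. *)
have := eBeta_ge0 m n; case: (eBeta m n) => // [r _|_] /=; first by rewrite mulrC.
rewrite mul0r mulry gtr0_sg ?mul1e//.
by rewrite lt_neqAle eq_sym k0 ker_ge0.
Qed.

Lemma rl_conv_integrable (R : realType) (a g m M : R) (phi : R -> R) (t : R) :
  0 < m <= 1 -> 0 < g <= 1 -> wbounded a g M phi ->
  lebesgue_measure.-integrable setT
    (EFin \o (fun s : R => ker m (t - s) * phi s)).
Proof.
move=> m01 g01 [mphi phiM].
have iM := integrableZl measurableT M (integrable_conv_ker a t m01 g01).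
apply: (le_integrable _ _ _ iM) => //.
- apply/measurable_EFinP; apply: measurable_funM => //.
  by apply: measurable_ker_comp; exact: measurable_funB.
- move=> s _; rewrite /= lee_fin normrM (ger0_norm (ker_ge0 _ _)).
  apply: le_trans (ler_norm _).
  by rewrite mulrCA ler_wpM2l ?ker_ge0.
Qed.

Lemma rl_conv_bound (R : realType) (a g m M : R) (phi : R -> R) (t : R) :
  0 < m <= 1 -> 0 < g <= 1 -> wbounded a g M phi ->
  `|rl_conv m phi t| <= M * (fine (eBeta m g) * ker (m + g) (t - a)).
Proof.
move=> m01 g01 wphi; have [mphi phiM] := wphi.
have ic := integrable_conv_ker a t m01 g01.
have ip := rl_conv_integrable t m01 g01 wphi.
rewrite -rl_conv_ker /rl_conv -RintegralZl//.
apply: le_trans (le_normr_Rintegral _ ip) _ => //.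
apply: le_Rintegral => //.
- exact: integrable_norm.
- exact: (integrableZl _ M ic).
by move=> s _; rewrite normrM (ger0_norm (ker_ge0 _ _)) mulrCA ler_wpM2l ?ker_ge0.
Qed.

(** For s < t monotonicity of the kernel makes the left-hand side equal to the first bracket. For s
    >= t that bracket is minus the left-hand side; the factor 2 in the other term pays for both,
    since [ker g (s - a) <= ker g (r - a)]. *)
Lemma ker_diff_bound (R : realType) (a g m r t t' s : R) :
  m <= 1 -> g <= 1 -> a < r -> r < t -> t <= t' ->
  `|ker m (t' - s) - ker m (t - s)| * ker g (s - a) <=
  (ker m (t - s) * ker g (s - a) - ker m (t' - s) * ker g (s - a)) +
  2 * ker g (r - a) * (ker m (t' - s) * ker 1 (s - r)).
Proof.
move=> m1 g1 ar rt tt'; have [st|ts] := ltP s t.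
  have kk : ker m (t' - s) <= ker m (t - s) by apply: ker_antitone => //; lra.
  rewrite distrC ger0_norm ?subr_ge0// mulrBl lerDl.
  by rewrite !mulr_ge0 ?ker_ge0.
rewrite (_ : ker m (t - s) = 0); last by rewrite ker_npos// subr_le0.
rewrite subr0 ger0_norm ?ker_ge0// mul0r sub0r (_ : ker 1 (s - r) = 1); last first.
  by rewrite ker_pos ?subrr ?powRr0//; lra.
have k0 := ker_ge0 m (t' - s).
have pp : ker g (s - a) <= ker g (r - a) by apply: ker_antitone => //; lra.
nra.
Qed.

(* Only [m <= 1] makes the kernel monotone, so that the absolute values inside
   the integral can be dropped at the price of the mass between [r] and [t']. *)
Lemma rl_conv_diff (R : realType) (a g m M : R) (phi : R -> R) (r t t' : R) :
  0 < m <= 1 -> 0 < g <= 1 -> wbounded a g M phi -> 0 <= M ->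
  a < r -> r < t -> t <= t' ->
  `|rl_conv m phi t' - rl_conv m phi t| <=
  M * (fine (eBeta m g) * (ker (m + g) (t - a) - ker (m + g) (t' - a)) +
       2 * ker g (r - a) * (fine (eBeta m 1) * ker (m + 1) (t' - r))).
Proof.
move=> m01 g01 wphi M0 ar rt tt'; have [mphi phiM] := wphi.
have o01 : 0 < (1 : R) <= 1 by lra.
have it := integrable_conv_ker a t m01 g01.
have it' := integrable_conv_ker a t' m01 g01.
have ir := integrable_conv_ker r t' m01 o01.
have pt := rl_conv_integrable t m01 g01 wphi.
have pt' := rl_conv_integrable t' m01 g01 wphi.
have iB : lebesgue_measure.-integrable setT (EFin \o (fun s : R =>
    ker m (t' - s) * phi s - ker m (t - s) * phi s)).
  by apply: eq_integrable (integrableB _ pt' pt).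
have iC : lebesgue_measure.-integrable setT (EFin \o (fun s : R =>
    ker m (t - s) * ker g (s - a) - ker m (t' - s) * ker g (s - a))).
  by apply: eq_integrable (integrableB _ it it').
have iD : lebesgue_measure.-integrable setT (EFin \o (fun s : R =>
    2 * ker g (r - a) * (ker m (t' - s) * ker 1 (s - r)))).
  by apply: eq_integrable (integrableZl _ (2 * ker g (r - a)) ir).
have iE : lebesgue_measure.-integrable setT (EFin \o (fun s : R =>
    (ker m (t - s) * ker g (s - a) - ker m (t' - s) * ker g (s - a)) +
    2 * ker g (r - a) * (ker m (t' - s) * ker 1 (s - r)))).
  by apply: eq_integrable (integrableD _ iC iD).
rewrite mulrBr -!rl_conv_ker {1 2}/rl_conv -RintegralB//.
apply: le_trans (le_normr_Rintegral _ iB) _ => //.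
rewrite /rl_conv -RintegralB// -RintegralZl// -RintegralD// -RintegralZl//.
apply: le_Rintegral => //.
- exact: integrable_norm.
- by apply: eq_integrable (integrableZl _ M iE).
move=> s _; rewrite -mulrBl normrM.
apply: le_trans (ler_wpM2l M0 (ker_diff_bound s _ _ ar rt tt')); [|lra|lra].
by rewrite mulrCA ler_wpM2l.
Qed.

Lemma ker_continuous (R : realType) (p x : R) : 0 < x ->
  {for x, continuous (@ker R p)}.
Proof.
move=> x0; have c : {for x, continuous (fun y : R => y `^ (p - 1))}.
  apply/differentiable_continuous/derivable1_diffP/derivable_powR.
  by rewrite in_itv/= x0.
rewrite /prop_for /continuous_at (ker_pos _ x0); apply: cvg_trans c.
apply: near_eq_cvg; near=> y; rewrite ker_pos//.
by near: y; exact: lt_nbhsr.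
Unshelve. all: by end_near. Qed.

Lemma ker_cvg0 (R : realType) (p : R) : 1 < p -> ker p x @[x --> (0 : R)] --> (0 : R).
Proof.
move=> p1; have k0 : ker p 0 = 0 by rewrite ker_npos.
rewrite -[X in _ --> X]k0; apply/left_right_continuousP; rewrite k0; split.
  apply: cvg_near_cst; near=> x; apply/ker_npos.
  by near: x; apply: nbhs_left_le.
have p10 : 0 < p - 1 by rewrite subr_gt0.
apply: cvg_trans (powR_cvg0 p10).
apply: near_eq_cvg; near=> x; rewrite ker_pos//.
Unshelve. all: by end_near. Qed.

Lemma ker_mono (R : realType) (p x y : R) : 1 <= p -> x <= y -> ker p x <= ker p y.
Proof.
move=> p1 xy; have [x0|x0] := leP x 0; first by rewrite ker_npos ?ker_ge0.
have y0 := lt_le_trans x0 xy; rewrite !ker_pos//.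
by apply: ge0_ler_powR; rewrite ?nnegrE ?subr_ge0 ?(ltW x0) ?(ltW y0).
Qed.

(** The neighbourhood is chosen before [phi], because the bound of [rl_conv_diff] involves only M
    and the kernels. *)
Lemma rl_conv_equicont (R : realType) (a g m M t0 e : R) :
  0 < m <= 1 -> 0 < g <= 1 -> 0 <= M -> a < t0 -> 0 < e ->
  \forall t \near t0, forall phi, wbounded a g M phi ->
    `|rl_conv m phi t - rl_conv m phi t0| <= e.
Proof.
move=> m01 g01 M0 at0 e0.
pose B := fine (eBeta m g); pose B1 := fine (eBeta m 1).
have B0 : 0 <= B by rewrite fine_ge0 ?eBeta_ge0.
have B10 : 0 <= B1 by rewrite fine_ge0 ?eBeta_ge0.
(* The point r = t0 - 2 |t - t0| lies below both t and t0 and within 3 |t - t0| of either, so the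
   mass between r and the larger of them tends to 0. *)
pose Om t := M * (B * `|ker (m + g) (t - a) - ker (m + g) (t0 - a)| +
  2 * ker g (t0 - 2 * `|t - t0| - a) * (B1 * ker (m + 1) (3 * `|t - t0|))).
have Om0 : Om t @[t --> t0] --> 0.
  have -> : 0 = M * (B * `|ker (m + g) (t0 - a) - ker (m + g) (t0 - a)| +
    2 * ker g (t0 - 2 * `|t0 - t0| - a) * (B1 * 0)).
    by rewrite subrr normr0 !mulr0 addr0 mulr0.
  have cd : `|t - t0| @[t --> t0] --> `|t0 - t0|.
    by apply: cvg_norm; apply: cvgB => //; exact: cvg_cst.
  apply: cvgMr; apply: cvgD.
    apply: cvgMr; apply: cvg_norm; apply: cvgB; last exact: cvg_cst.
    apply: (@cvg_comp _ _ _ (fun t => t - a) (ker (m + g)) _ (nbhs (t0 - a))).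
      by apply: cvgB => //; exact: cvg_cst.
    by apply: ker_continuous; rewrite subr_gt0.
  apply: cvgM.
    apply: cvgMr; apply: (@cvg_comp _ _ _ _ (ker g) _ (nbhs (t0 - 2 * `|t0 - t0| - a))).
      apply: cvgB; last exact: cvg_cst.
      by apply: cvgB; [exact: cvg_cst|exact: cvgMr].
    by apply: ker_continuous; rewrite subrr normr0 mulr0 subr0 subr_gt0.
  apply: cvgMr; apply: (@cvg_comp _ _ _ _ (ker (m + 1)) _ (nbhs (3 * `|t0 - t0|))).
    exact: cvgMr.
  by rewrite subrr normr0 mulr0; apply: ker_cvg0; lra.
have d0 : 0 < (t0 - a) / 2 by lra.
near=> t => phi wphi.
have Ome : Om t <= e.
  apply: le_trans (ler_norm _) _; near: t.
  by move/cvgr0Pnorm_le : Om0; apply.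
have art : a < t0 - 2 * `|t - t0|.
  suff : `|t0 - t| < (t0 - a) / 2 by rewrite distrC; lra.
  by near: t; exact: (nbhsx_ballx t0 _ d0).
apply: le_trans Ome; set r := t0 - _ in art.
have [tt0|t0t|->] := ltgtP t t0; last first.
- by rewrite subrr normr0 !mulr_ge0// addr_ge0// !mulr_ge0// ker_ge0.
- have rt0 : r < t0 by rewrite /r gtr0_norm; lra.
  apply: le_trans (rl_conv_diff m01 g01 wphi M0 art rt0 (ltW t0t)) _.
  apply: ler_wpM2l => //; apply: lerD.
    by apply: ler_wpM2l => //; rewrite distrC ler_norm.
  apply: ler_wpM2l; first by rewrite mulr_ge0 ?ker_ge0.
  apply: ler_wpM2l => //; apply: ker_mono; first lra.
  by rewrite /r gtr0_norm; lra.
- have rt : r < t by rewrite /r ltr0_norm; lra.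
  rewrite distrC; apply: le_trans (rl_conv_diff m01 g01 wphi M0 art rt (ltW tt0)) _.
  apply: ler_wpM2l => //; apply: lerD.
    by apply: ler_wpM2l => //; rewrite ler_norm.
  apply: ler_wpM2l; first by rewrite mulr_ge0 ?ker_ge0.
  apply: ler_wpM2l => //; apply: ker_mono; first lra.
  by rewrite /r ltr0_norm; lra.
Unshelve. all: by end_near. Qed.

Lemma wbounded_norm (R : realType) (a g M : R) (phi : R -> R) :
  wbounded a g M phi -> wbounded a g M (fun s => `|phi s|).
Proof.
move=> [mphi phiM]; split; first exact: measurableT_comp.
by move=> s; rewrite normr_id.
Qed.

Lemma EFin_rl_conv (R : realType) (a g m M : R) (phi : R -> R) (t : R) :
  0 < m <= 1 -> 0 < g <= 1 -> wbounded a g M phi ->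
  (\int[lebesgue_measure]_s (ker m (t - s) * phi s)%:E = (rl_conv m phi t)%:E)%E.
Proof.
move=> m01 g01 wphi; rewrite /rl_conv /Rintegral fineK//.
by apply: integrable_fin_num => //; exact: rl_conv_integrable wphi.
Qed.

Lemma rl_conv_conv (R : realType) (a g m n M : R) (phi : R -> R) (t : R) :
  0 < m -> 0 < n -> m + n <= 1 -> 0 < g <= 1 -> wbounded a g M phi ->
  rl_conv m (rl_conv n phi) t = fine (eBeta m n) * rl_conv (m + n) phi t.
Proof.
move=> m0 n0 mn1 g01 wphi.
have m01 : 0 < m <= 1 by lra.
have n01 : 0 < n <= 1 by lra.
have mn01 : 0 < m + n <= 1 by lra.
have [mphi phiM] := wphi.
pose h (z : R * R) := (ker m (t - z.1) * ker n (z.1 - z.2) * phi z.2)%:E.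
have mh : measurable_fun setT h.
  apply/measurable_EFinP; apply: measurable_funM; first apply: measurable_funM.
  - by apply: measurable_ker_comp; apply: measurable_funB.
  - by apply: measurable_ker_comp; apply: measurable_funB.
  - exact: measurableT_comp.
(* Applied to |phi| this gives the absolute integrability that Fubini's theorem requires; applied to
   [phi], the value of the double integral. *)
have inner (psi : R -> R) s :
    (\int[lebesgue_measure]_r (ker m (t - r) * ker n (r - s) * psi s)%:E =
     (fine (eBeta m n) * (ker (m + n) (t - s) * psi s))%:E)%E.
  under eq_integral do rewrite EFinM.
  rewrite (integralZr measurableT (integrable_conv_ker s t m01 n01)).
  by rewrite integral_conv_ker -(fineK (eBeta_fin m01 n01)) -!EFinM mulrCA mulrA.
have ih : (lebesgue_measure \x lebesgue_measure)%E.-integrable setT h.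
  apply/integrable21ltyP => //.
  under eq_integral => s _.
    under eq_integral => r _ do
      rewrite /h /= normrM (ger0_norm (mulr_ge0 (ker_ge0 _ _) (ker_ge0 _ _))).
    rewrite (inner (fun s => `|phi s|)) EFinM; over.
  rewrite (integralZl measurableT (rl_conv_integrable t mn01 g01 (wbounded_norm wphi))).
  by rewrite (EFin_rl_conv t mn01 g01 (wbounded_norm wphi)) -EFinM ltry.
have := Fubini ih.
under eq_integral => r _.
  under eq_integral => s _ do rewrite /h /= -mulrA EFinM.
  rewrite (integralZl measurableT (rl_conv_integrable r n01 g01 wphi)).
  rewrite (EFin_rl_conv r n01 g01 wphi) -EFinM; over.
under [in RHS]eq_integral => s _ do rewrite inner EFinM.
rewrite (integralZl measurableT (rl_conv_integrable t mn01 g01 wphi)).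
by rewrite (EFin_rl_conv t mn01 g01 wphi) -EFinM => /(congr1 fine).
Qed.

Lemma rl_conv_cvg (R : realType) (a g m M : R) (phi_ : nat -> R -> R)
    (phi : R -> R) (t : R) :
  0 < m <= 1 -> 0 < g <= 1 -> (forall n, wbounded a g M (phi_ n)) ->
  (forall s, phi_ n s @[n --> \oo] --> phi s) ->
  rl_conv m (phi_ n) t @[n --> \oo] --> rl_conv m phi t.
Proof.
move=> m01 g01 wphi cphi.
have mphi : measurable_fun setT phi.
  by apply: (measurable_fun_cvg (fun n => (wphi n).1)) => s _; exact: cphi.
have mk (psi : R -> R) : measurable_fun setT psi ->
    measurable_fun setT (EFin \o (fun s : R => ker m (t - s) * psi s)).
  move=> mpsi; apply/measurable_EFinP; apply: measurable_funM => //.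
  by apply: measurable_ker_comp; exact: measurable_funB.
have iM := integrableZl measurableT M (integrable_conv_ker a t m01 g01).
have [] := @dominated_convergence _ _ R lebesgue_measure _ measurableT
  (fun n => EFin \o (fun s : R => ker m (t - s) * phi_ n s))
  (EFin \o (fun s : R => ker m (t - s) * phi s)) _ _ _ _ iM.
- by move=> n; exact: (mk _ (wphi n).1).
- exact: mk.
- apply: aeW => s _; apply: cvg_EFin; first exact: nearW.
  by apply: cvgMr; exact: cphi.
- apply: aeW => s n _; rewrite /= -EFinM lee_fin normrM (ger0_norm (ker_ge0 _ _)).
  by rewrite mulrCA ler_wpM2l ?ker_ge0//; exact: (wphi n).2.
move=> ip _ c; apply: fine_cvg; rewrite fineK; first exact: c.
exact: integrable_fin_num.
Qed.

Lemma rl_convD (R : realType) (a g m M N : R) (phi psi : R -> R) (t : R) :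
  0 < m <= 1 -> 0 < g <= 1 -> wbounded a g M phi -> wbounded a g N psi ->
  rl_conv m (fun s => phi s + psi s) t = rl_conv m phi t + rl_conv m psi t.
Proof.
move=> m01 g01 wphi wpsi; rewrite /rl_conv -RintegralD//.
- by apply: eq_Rintegral => s _; rewrite mulrDr.
- exact: rl_conv_integrable wphi.
- exact: rl_conv_integrable wpsi.
Qed.

Lemma rl_convZ (R : realType) (a g m M c : R) (phi : R -> R) (t : R) :
  0 < m <= 1 -> 0 < g <= 1 -> wbounded a g M phi ->
  rl_conv m (fun s => c * phi s) t = c * rl_conv m phi t.
Proof.
move=> m01 g01 wphi; rewrite /rl_conv -RintegralZl//.
- by apply: eq_Rintegral => s _; rewrite mulrCA.
- exact: rl_conv_integrable wphi.
Qed.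

Lemma rl_conv_local (R : realType) (m : R) (phi psi : R -> R) (t : R) :
  (forall s, s < t -> phi s = psi s) -> rl_conv m phi t = rl_conv m psi t.
Proof.
move=> pp; apply: eq_Rintegral => s _; have [st|ts] := ltP s t.
  by rewrite pp.
by rewrite ker_npos ?mul0r// subr_le0.
Qed.

(** * Fractional integrals in weighted spaces *)

Lemma kerM (R : realType) (p q x : R) : ker p x * ker q x = ker (p + q - 1) x.
Proof.
have [x0|x0] := leP x 0; first by rewrite !ker_npos ?mulr0.
rewrite !ker_pos// -powRD ?(gt_eqF x0) ?implybT//.
by congr (_ `^ _); ring.
Qed.

Lemma ker1 (R : realType) (x : R) : 0 < x -> ker 1 x = 1.
Proof. by move=> x0; rewrite ker_pos// subrr powRr0. Qed.

Lemma rl_conv_le0 (R : realType) (a g m M : R) (phi : R -> R) (t : R) :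
  0 < m <= 1 -> 0 < g <= 1 -> wbounded a g M phi -> t <= a ->
  rl_conv m phi t = 0.
Proof.
move=> m01 g01 wphi ta; apply/eqP; rewrite -normr_le0.
apply: le_trans (rl_conv_bound t m01 g01 wphi) _.
by rewrite [ker _ _]ker_npos ?mulr0// subr_le0.
Qed.

Lemma norm_mulB_le (F : numDomainType) (x y u v : F) :
  `|x * u - y * v| <= `|x| * `|u - v| + `|x - y| * `|v|.
Proof.
rewrite -!normrM; apply: le_trans (ler_normD _ _).
by rewrite mulrBr mulrBl addrA subrK.
Qed.

(** The weight [ker (2 - g) (t - a)] is (t - a)^(1 - g) for t > a and 0 otherwise, so the product
    extends the weighted integral to the whole line, with value 0 up to a. *)
Lemma wrl_conv_equicont (R : realType) (a g m M t0 e : R) :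
  0 < m <= 1 -> 0 < g <= 1 -> 0 <= M -> 0 < e ->
  \forall t \near t0, forall phi, wbounded a g M phi ->
    `|ker (2 - g) (t - a) * rl_conv m phi t -
      ker (2 - g) (t0 - a) * rl_conv m phi t0| <= e.
Proof.
move=> m01 g01 M0 e0.
pose B := fine (eBeta m g).
have B0 : 0 <= B by rewrite fine_ge0 ?eBeta_ge0.
have [t0a|at0|->] := ltgtP t0 a.
- near=> t => phi wphi.
  have ta : t <= a by apply: ltW; near: t; exact: lt_nbhsl.
  rewrite (@ker_npos _ _ (t - a)) ?subr_le0// (@ker_npos _ _ (t0 - a)) ?subr_le0 ?(ltW t0a)//.
  by rewrite !mul0r subrr normr0 (ltW e0).
- pose C := M * (B * ker (m + g) (t0 - a)).
  have C0 : 0 <= C by rewrite !mulr_ge0 ?ker_ge0.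
  pose K := ker (2 - g) (t0 - a) + 1.
  have K0 : 0 < K by rewrite ltr_wpDl ?ker_ge0.
  have ck : ker (2 - g) (t - a) @[t --> t0] --> ker (2 - g) (t0 - a).
    apply: (@cvg_comp _ _ _ (fun t => t - a) _ _ (nbhs (t0 - a))).
      by apply: cvgB => //; exact: cvg_cst.
    by apply: ker_continuous; rewrite subr_gt0.
  have e1 : 0 < e / (2 * K) by rewrite divr_gt0// mulr_gt0.
  have e2 : 0 < e / (2 * (C + 1)) by rewrite divr_gt0// mulr_gt0// ltr_wpDl.
  near=> t => phi wphi.
  have h1 : `|rl_conv m phi t - rl_conv m phi t0| <= e / (2 * K).
    by move: phi wphi; near: t; exact: rl_conv_equicont.
  have h2 : `|ker (2 - g) (t - a)| <= K.
    rewrite ger0_norm ?ker_ge0//; near: t.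
    by apply: (cvgr_le _ ck); rewrite ltrDl.
  have h3 : `|ker (2 - g) (t - a) - ker (2 - g) (t0 - a)| <= e / (2 * (C + 1)).
    by rewrite distrC; near: t; move/cvgrPdist_le : ck; apply.
  have h4 := rl_conv_bound t0 m01 g01 wphi.
  apply: le_trans (norm_mulB_le _ _ _ _) _.
  rewrite (_ : e = K * (e / (2 * K)) + e / (2 * (C + 1)) * (C + 1)); last first.
    by field; rewrite !gt_eqF// ltr_wpDl.
  apply: lerD; apply: ler_pM => //.
  by apply: le_trans h4 _; rewrite lerDl.
(* At a the weight itself jumps when g = 1, but the product is bounded by a multiple of
   [ker (m + 1) (t - a)], which tends to 0. *)
- have cB : M * (B * ker (m + 1) (t - a)) @[t --> a] --> M * (B * 0).
    apply: cvgMr; apply: cvgMr.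
    apply: (@cvg_comp _ _ _ (fun t => t - a) _ _ (nbhs (a - a))).
      by apply: cvgB => //; exact: cvg_cst.
    by rewrite subrr; apply: ker_cvg0; lra.
  near=> t => phi wphi.
  rewrite [X in _ - X * _]ker_npos ?subrr// mul0r subr0 normrM.
  rewrite ger0_norm ?ker_ge0//.
  apply: (@le_trans _ _ (M * (B * ker (m + 1) (t - a)))).
    have := rl_conv_bound t m01 g01 wphi => /(ler_wpM2l (ker_ge0 (2 - g) (t - a))).
    move=> /le_trans; apply; rewrite mulrCA ler_wpM2l// mulrCA ler_wpM2l//.
    by rewrite kerM (_ : 2 - g + (m + g) - 1 = m + 1)//; ring.
  by near: t; apply: (cvgr_le _ cB); rewrite !mulr0.
Unshelve. all: by end_near. Qed.

Lemma wrl_conv_continuous (R : realType) (a g m M : R) (phi : R -> R) :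
  0 < m <= 1 -> 0 < g <= 1 -> 0 <= M -> wbounded a g M phi ->
  continuous (fun t => ker (2 - g) (t - a) * rl_conv m phi t).
Proof.
move=> m01 g01 M0 wphi t0; apply/cvgrPdist_le => e e0.
near=> t; rewrite distrC; move: phi wphi; near: t.
exact: wrl_conv_equicont.
Unshelve. all: by end_near. Qed.

Lemma rl_conv_cvg_right (R : realType) (a g m M : R) (phi : R -> R) :
  0 < m <= 1 -> 0 < g <= 1 -> 1 < m + g -> wbounded a g M phi ->
  rl_conv m phi t @[t --> a^'+] --> 0.
Proof.
move=> m01 g01 mg wphi; apply/norm_cvg0P.
have cB : M * (fine (eBeta m g) * ker (m + g) (t - a)) @[t --> a^'+] --> 0.
  have -> : 0 = M * (fine (eBeta m g) * 0) by rewrite !mulr0.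
  apply: cvgMr; apply: cvgMr; apply: cvg_at_right_filter.
  apply: (@cvg_comp _ _ _ (fun t => t - a) _ _ (nbhs (a - a))).
    by apply: cvgB => //; exact: cvg_cst.
  by rewrite subrr; exact: ker_cvg0.
apply: (squeeze_cvgr _ (cvg_cst 0) cB); near=> t.
by rewrite normr_ge0 (rl_conv_bound t m01 g01 wphi).
Unshelve. all: by end_near. Qed.

(** With x, y, z, k = Gamma(m), Gamma(n), Gamma(m + n), B(m, n), this passes from bare convolutions
    to the normalised semigroup law. *)
Lemma invr_mul_transfer (F : realFieldType) (x y z k u v : F) :
  0 < x -> 0 < y -> 0 < z -> x * y = k * z -> y * u = k * v -> x^-1 * u = z^-1 * v.
Proof.
move=> x0 y0 z0 xy yu; apply: (mulfI (lt0r_neq0 (mulr_gt0 (mulr_gt0 x0 y0) z0))).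
transitivity (z * (y * u)); first by field; rewrite gt_eqF.
by rewrite yu xy; field; rewrite gt_eqF.
Qed.

Section weighted.
Variables (R : realType) (a b g : R).
Hypotheses (ab : a < b) (g01 : 0 < g <= 1).

Local Notation cut F := (F \_ `]a, b]).

Lemma cutE (F : R -> R) s : s \in `]a, b] -> cut F s = F s.
Proof. by move=> sab; rewrite patchE ifT// inE. Qed.

Lemma cut_le (F : R -> R) s : s <= a -> cut F s = 0.
Proof.
by move=> sa; rewrite patchE ifF//; apply/negP; rewrite inE/= in_itv/= ltNge sa.
Qed.

Lemma weightK x : 0 < x -> x `^ (1 - g) * ker g x = 1.
Proof.
move=> x0; rewrite ker_pos// -powRD ?(gt_eqF x0) ?implybT//.
by rewrite (_ : 1 - g + (g - 1) = 0) ?powRr0//; ring.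
Qed.

Lemma C_weightedE (F h : R -> R) t :
  (forall t, t \in `]a, b] -> h t = (t - a) `^ (1 - g) * F t) ->
  t \in `]a, b] -> F t = h t * ker g (t - a).
Proof.
move=> hF tab; rewrite hF// mulrAC weightK ?mul1r//.
by move: tab; rewrite in_itv/= subr_gt0 => /andP[].
Qed.

Lemma C_weighted_continuous (F : R -> R) : C_weighted a b g F ->
  {within `]a, b], continuous F}.
Proof.
move=> [h [ch hF]].
have : {within `]a, b], continuous (fun t => h t * ker g (t - a))}.
  have ch' : {within `]a, b], continuous h}.
    by apply: continuous_subspaceW ch; apply: subset_itvr; rewrite bnd_simp.
  have ck : {within `]a, b], continuous (fun t => ker g (t - a))}.
    apply: continuous_in_subspaceT => t; rewrite inE/= in_itv/= => /andP[at' _].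
    apply: (@continuous_comp _ _ _ (fun t => t - a)).
      by apply: continuousB => //; exact: cst_continuous.
    by apply: ker_continuous; rewrite subr_gt0.
  by move=> t; apply: cvgM; [exact: ch'|exact: ck].
apply: subspace_eq_continuous => t; rewrite inE => tab.
by rewrite /from_subspace /= [RHS](C_weightedE hF tab).
Qed.

Lemma C_weighted_wbounded (F : R -> R) : C_weighted a b g F ->
  exists2 M, 0 <= M & wbounded a g M (cut F).
Proof.
move=> CF; have cF := C_weighted_continuous CF; have [h [ch hF]] := CF.
have [|c _ hc] := @EVT_max R (fun t => `|h t|) a b (ltW ab).
  by move=> t; apply: continuous_comp; [exact: ch|exact: norm_continuous].
exists `|h c| => //; split.
  apply/(measurable_restrictT _ _).1 => //.
  exact: subspace_continuous_measurable_fun.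
move=> s; have [sab|sab] := boolP (s \in `]a, b]); last first.
  rewrite patchE ifF; first by rewrite normr0 mulr_ge0 ?ker_ge0.
  by apply/negP; rewrite inE; apply/negP.
rewrite cutE// (C_weightedE hF sab) normrM (ger0_norm (ker_ge0 _ _)).
by apply: ler_wpM2r; [exact: ker_ge0|apply: hc; apply: subset_itv_oc_cc sab].
Qed.

Lemma RL_intE (F : R -> R) m t : 0 < m -> t <= b ->
  RL_int a m F t = (Gamma m)^-1 * rl_conv m (cut F) t.
Proof.
move=> m0 tb; rewrite /RL_int gt_eqF//; congr (_ * _).
rewrite Rintegral_mkcond; apply: eq_Rintegral => s _.
rewrite patchE; case: ifPn => [|/negP]; rewrite inE/= in_itv/=.
  move=> /andP[as' st]; rewrite /RL_kernel ker_pos ?subr_gt0// cutE//.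
  by rewrite in_itv/= as' (le_trans (ltW st)).
move=> /negP; rewrite negb_and -!leNgt => /orP[sa|ts].
  by rewrite cut_le// mulr0.
by rewrite ker_npos ?mul0r// subr_le0.
Qed.

Lemma C_weighted_RL_integrable (F : R -> R) m t : C_weighted a b g F ->
  0 <= m <= 1 -> t <= b -> RL_integrable a m F t.
Proof.
move=> /C_weighted_wbounded[M M0 wF] /andP[m0 m1] tb.
have [->|mn0] := eqVneq m 0; first by left.
right; have m01 : 0 < m <= 1 by rewrite lt_neqAle eq_sym mn0 m0.
have := rl_conv_integrable t m01 g01 wF.
move=> iT; have : lebesgue_measure.-integrable `]a, t[
    (EFin \o (fun s : R => ker m (t - s) * cut F s)).
  exact: integrableS iT.
apply: eq_integrable => // s; rewrite inE/= in_itv/= => /andP[as' st].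
rewrite /RL_kernel ker_pos ?subr_gt0// cutE//.
by rewrite in_itv/= as' (le_trans (ltW st)).
Qed.

Lemma C_weighted_RL_int (F : R -> R) m : C_weighted a b g F ->
  0 <= m <= 1 -> C_weighted a b g (RL_int a m F).
Proof.
move=> CF /andP[m0 m1]; have [mz|mn0] := eqVneq m 0.
  have [h [ch hF]] := CF; exists h; split => // t tab.
  by rewrite /RL_int mz eqxx hF.
have m01 : 0 < m <= 1 by rewrite lt_neqAle eq_sym mn0 m0.
have [M M0 wF] := C_weighted_wbounded CF.
exists (fun t => (Gamma m)^-1 * (ker (2 - g) (t - a) * rl_conv m (cut F) t)); split.
  apply: continuous_subspaceT => t; apply: cvgMr.
  exact: (wrl_conv_continuous m01 g01 M0 wF).
move=> t; rewrite in_itv/= => /andP[at' tb].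
rewrite RL_intE//; last by case/andP : m01.
rewrite ker_pos ?subr_gt0// mulrCA; congr (_ `^ _ * _); ring.
Qed.

Lemma RL_int_semigroup (F : R -> R) m n t : C_weighted a b g F ->
  0 < m -> 0 < n -> m + n <= 1 -> t <= b ->
  RL_int a m (RL_int a n F) t = RL_int a (m + n) F t.
Proof.
move=> CF m0 n0 mn1 tb.
have m01 : 0 < m <= 1 by lra.
have n01 : 0 < n <= 1 by lra.
have mn01 : 0 < m + n <= 1 by lra.
have [M M0 wF] := C_weighted_wbounded CF.
have [|N N0 wI] := C_weighted_wbounded (@C_weighted_RL_int F n CF _); first lra.
have := rl_conv_conv t m0 n0 mn1 g01 wF.
have -> : rl_conv m (rl_conv n (cut F)) t = Gamma n * rl_conv m (cut (RL_int a n F)) t.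
  rewrite -(rl_convZ _ _ m01 g01 wI); apply: rl_conv_local => s st.
  have [sa|as'] := leP s a.
    by rewrite (rl_conv_le0 n01 g01 wF)// cut_le// mulr0.
  have sb : s <= b by rewrite (le_trans (ltW st)).
  rewrite cutE; last by rewrite in_itv/= as' sb.
  by rewrite RL_intE// mulVKf// gt_eqF ?Gamma_gt0.
rewrite !RL_intE//; last lra.
exact: invr_mul_transfer (Gamma_gt0 m01) (Gamma_gt0 n01) (Gamma_gt0 mn01) (Gamma_eBeta m0 n0 mn1).
Qed.

Lemma RL_int_pow m t : 0 < m <= 1 -> t <= b ->
  RL_int a m (fun s => (s - a) `^ (g - 1)) t =
  (Gamma m)^-1 * (fine (eBeta m g) * ker (m + g) (t - a)).
Proof.
move=> m01 tb; rewrite RL_intE//; last by case/andP : m01.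
congr (_ * _); rewrite -rl_conv_ker; apply: rl_conv_local => s st.
have [sa|as'] := leP s a; first by rewrite cut_le// ker_npos// subr_le0.
rewrite cutE ?ker_pos ?subr_gt0//.
by rewrite in_itv/= as' (le_trans (ltW st)).
Qed.

Lemma C_weighted_pow (k : R) : C_weighted a b g (fun s => k * (s - a) `^ (g - 1)).
Proof.
exists (fun=> k); split; first exact: cst_continuous.
move=> t; rewrite in_itv/= -subr_gt0 => /andP[ta _].
by rewrite mulrCA -ker_pos// weightK// mulr1.
Qed.

Lemma C_weightedD (F G : R -> R) : C_weighted a b g F -> C_weighted a b g G ->
  C_weighted a b g (fun s => F s + G s).
Proof.
move=> [h [ch hF]] [k [ck kG]]; exists (fun t => h t + k t); split.
  by move=> t; apply: continuousD; [exact: ch|exact: ck].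
by move=> t tab; rewrite hF// kG// mulrDr.
Qed.

Lemma C_weighted_eq (F G : R -> R) : (forall t, t \in `]a, b] -> F t = G t) ->
  C_weighted a b g F -> C_weighted a b g G.
Proof. by move=> FG [h [ch hF]]; exists h; split => // t tab; rewrite hF// FG. Qed.

Lemma RL_intD (F G : R -> R) m t : C_weighted a b g F -> C_weighted a b g G ->
  0 < m <= 1 -> t <= b ->
  RL_int a m (fun s => F s + G s) t = RL_int a m F t + RL_int a m G t.
Proof.
move=> /C_weighted_wbounded[M _ wF] /C_weighted_wbounded[N _ wG] m01 tb.
rewrite !RL_intE//; [|by case/andP : m01..].
rewrite -mulrDr -(rl_convD t m01 g01 wF wG); congr (_ * rl_conv _ _ _).
by apply/funext => s; rewrite !patchE; case: ifP => //; rewrite addr0.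
Qed.

Lemma RL_intZ (F : R -> R) k m t : C_weighted a b g F ->
  0 < m <= 1 -> t <= b ->
  RL_int a m (fun s => k * F s) t = k * RL_int a m F t.
Proof.
move=> /C_weighted_wbounded[M _ wF] m01 tb.
rewrite !RL_intE//; [|by case/andP : m01..].
rewrite mulrCA -(rl_convZ k t m01 g01 wF); congr (_ * rl_conv _ _ _).
by apply/funext => s; rewrite !patchE; case: ifP => //; rewrite mulr0.
Qed.

Lemma eq_RL_int (F G : R -> R) m t : t \in `]a, b] ->
  (forall s, s \in `]a, b] -> F s = G s) -> RL_int a m F t = RL_int a m G t.
Proof.
rewrite in_itv/= => /andP[at' tb] FG; rewrite /RL_int.
case: ifP => _; first by rewrite FG// in_itv/= at'.
congr (_ * _); apply: eq_Rintegral => s; rewrite inE/= in_itv/= => /andP[as' st].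
by rewrite /RL_kernel FG// in_itv/= as' (le_trans (ltW st)).
Qed.

End weighted.

(** * The fundamental theorem of fractional calculus *)

(** In the application c is K Gamma(gamma), the image of the singular term of z under I^(1 - gamma);
    since difference quotients do not see it, D^gamma z = D^mu F. *)
Lemma diff_quot_eq (R : realType) (a b c : R) (G1 G2 : R -> R) t :
  t \in `]a, b] -> (forall s, s \in `]a, b] -> G1 s = c + G2 s) ->
  diff_quot a b G1 t = diff_quot a b G2 t.
Proof.
move=> tab G12; rewrite /diff_quot.
have E s : s \in `]a, b] -> (G1 s - G1 t) / (s - t) = (G2 s - G2 t) / (s - t).
  by move=> sab; congr (_ / _); rewrite !G12//; ring.
by apply/seteqP; split; apply: near_eq_cvg; rewrite near_withinE;
  apply: nearW => s sab /=; rewrite E.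
Qed.

Lemma ddt_eq (R : realType) (a b c : R) (G1 G2 : R -> R) t :
  t \in `]a, b] -> (forall s, s \in `]a, b] -> G1 s = c + G2 s) ->
  ddt a b G1 t = ddt a b G2 t.
Proof. by move=> tab G12; rewrite /ddt (diff_quot_eq tab G12). Qed.

Lemma differentiable_at_eq (R : realType) (a b c : R) (G1 G2 : R -> R) t :
  t \in `]a, b] -> (forall s, s \in `]a, b] -> G1 s = c + G2 s) ->
  differentiable_at a b G2 t -> differentiable_at a b G1 t.
Proof. by move=> tab G12; rewrite /differentiable_at (diff_quot_eq tab G12). Qed.

(** At an interior point (a, b] is a neighbourhood of t, so the restriction in [diff_quot] changes
    nothing; what remains is the substitution s = h + t. *)
Lemma is_derive_ddt (R : realType) (a b : R) (G : R -> R) t :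
  t \in `]a, b[ -> differentiable_at a b G t -> is_derive t 1 G (ddt a b G t).
Proof.
move=> tab dG; have dl : diff_quot a b G t --> ddt a b G t by [].
have c : h^-1 *: ((G \o shift t) (h *: (1 : R)) - G t) @[h --> (0 : R)^'] -->
    ddt a b G t.
  move=> A /dl; rewrite /diff_quot /nbhs/= /within/= /nbhs/= => nA.
  have nab : \forall s \near t, s \in `]a, b] .
    near=> s; apply: subset_itv_oo_oc; near: s.
    exact: (near_in_itvoo tab).
  have /nbhs_ballP[e /= e0 eA] : nbhs t (fun s => (s \in `]a, b]) /\
      (s != t -> (s \in `]a, b]) -> A ((G s - G t) / (s - t)))).
    exact: (filterI nab nA).
  change (nbhs (0 : R) (fun h : R => h != 0 ->
    A (h^-1 *: (G (h *: (1 : R) + t) - G t)))).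
  apply/nbhs_ballP; exists e => // h /=.
  rewrite /ball/= sub0r normrN => he h0.
  have := eA (h + t); rewrite /ball/= opprD addrCA subrr addr0 normrN => /(_ he)[htab].
  move=> /(_ _ htab); rewrite /GRing.scale/= mulr1 addrK mulrC; apply.
  by rewrite -subr_eq0 addrK.
split; first by apply/cvg_ex; exists (ddt a b G t).
exact: cvg_lim.
Unshelve. all: by end_near. Qed.

Lemma differentiable_at_continuous (R : realType) (a b : R) (G : R -> R) :
  (forall t, t \in `]a, b] -> differentiable_at a b G t) ->
  {within `]a, b], continuous G}.
Proof.
move=> dG; apply/subspace_continuousP => t tab.
have dl : diff_quot a b G t --> ddt a b G t by exact: dG.
have c0 : (s - t) @[s --> within `]a, b] t^'] --> (0 : R).
  rewrite -(subrr t); apply: cvgB; last exact: cvg_cst.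
  by apply: cvg_trans (cvg_within _) _; exact: nbhs_dnbhs.
have c : (G s - G t) / (s - t) * (s - t) @[s --> within `]a, b] t^'] --> (0 : R).
  by rewrite -(mulr0 (ddt a b G t)); exact: cvgM.
have nt : \forall s \near within `]a, b] (t : R)^', s != t.
  by apply: (cvg_within `]a, b]); exact: (nbhs_dnbhs_neq (t : R)).
have {}c : (G s - G t) @[s --> within `]a, b] t^'] --> (0 : R).
  apply: cvg_trans c; apply: near_eq_cvg.
  near=> s; rewrite divfK// subr_eq0.
  by near: s; exact: nt.
apply/cvgrPdist_le => e e0.
move/cvgr0Pnorm_le : c => /(_ _ e0); rewrite !near_withinE => c.
apply: filterS c => s cs sab.
have [->|st] := eqVneq s t; first by rewrite subrr normr0 ltW.
by rewrite distrC; exact: cs.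
Unshelve. all: by end_near. Qed.

Lemma derive0_constant (R : realType) (a b : R) (E : R -> R) :
  {within `]a, b], continuous E} ->
  (forall t, t \in `]a, b[ -> is_derive t 1 E 0) ->
  forall x y, a < x -> x < y -> y <= b -> E x = E y.
Proof.
move=> cE dE x y ax xy yb.
have dE' z : z \in `]x, y[ -> is_derive z 1 E ((fun=> 0) z).
  rewrite in_itv/= => /andP[xz zy]; apply: dE.
  by rewrite in_itv/= (lt_trans ax xz) (lt_le_trans zy yb).
have cE' : {within `[x, y], continuous E}.
  apply: continuous_subspaceW cE => z/=; rewrite !in_itv/= => /andP[xz zy].
  by rewrite (lt_le_trans ax xz) (le_trans zy yb).
have [c _] := MVT xy dE' cE'.
by rewrite mul0r => /eqP; rewrite subr_eq0 => /eqP.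
Qed.

Lemma within_cvg_at_left (R : realType) (a b : R) (F : R -> R) : a < b ->
  {within `]a, b], continuous F} -> F s @[s --> b^'-] --> F b.
Proof.
move=> ab cF; have bab : b \in `]a, b] by rewrite in_itv/= ab lexx.
have /subspace_continuousP/(_ b bab) := cF.
apply: cvg_trans; apply: cvg_app => A nA.
have nA' : nbhs b (fun s => (s \in `]a, b]) -> A s) by exact: nA.
change (nbhs b (fun s : R => s < b -> A s)).
near=> s => sb; apply: (near nA' s) => //.
by rewrite in_itv/= (ltW sb) andbT; near: s; exact: lt_nbhsr.
Unshelve. all: by end_near. Qed.

Section fundamental_theorem.
Variables (R : realType) (a b g : R).
Hypotheses (ab : a < b) (g01 : 0 < g <= 1).

Local Notation cut F := (F \_ `]a, b]).

Lemma continuous_cut (F : R -> R) x : {within `]a, b], continuous F} ->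
  x \in `]a, b[ -> {for x, continuous (cut F)}.
Proof.
move=> cF xab; have {}cF : {within `]a, b[, continuous F}.
  by apply: continuous_subspaceW cF; exact: subset_itv_oo_oc.
rewrite continuous_open_subspace in cF; last exact: interval_open.
have xab' : x \in `]a, b] by exact: subset_itv_oo_oc.
rewrite /prop_for /continuous_at cutE//.
apply: cvg_trans (cF x _); last by rewrite inE.
apply: near_eq_cvg; near=> s; rewrite cutE//.
by apply: subset_itv_oo_oc; near: s; exact: (near_in_itvoo xab).
Unshelve. all: by end_near. Qed.

Lemma integrable_cut (F : R -> R) : C_weighted a b g F ->
  lebesgue_measure.-integrable `]a, b] (EFin \o cut F).
Proof.
move=> /(C_weighted_wbounded ab)[M M0 wF].
have o01 : 0 < (1 : R) <= 1 by lra.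
(* The kernel of order 1 ending at b + 1 equals 1 on (a, b], which makes plain integrability a
   special case. *)
have iT := rl_conv_integrable (b + 1) o01 g01 wF.
have : lebesgue_measure.-integrable `]a, b]
    (EFin \o (fun s : R => ker 1 (b + 1 - s) * cut F s)).
  exact: integrableS iT.
apply: eq_integrable => // s; rewrite inE/= in_itv/= => /andP[_ sb].
by rewrite ker1 ?mul1r//; lra.
Qed.

Lemma RL_int1E (F : R -> R) t : C_weighted a b g F -> t \in `]a, b] ->
  RL_int a 1 F t = \int[lebesgue_measure]_(s in `]a, t]) (cut F s).
Proof.
move=> CF; rewrite in_itv/= => /andP[at' tb].
rewrite /RL_int oner_eq0 Gamma1 invr1 mul1r.
rewrite -Rintegral_itv_bndo_bndc; last first.
  apply: integrableS (integrable_cut CF) => //.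
  by apply: subset_itvl; rewrite bnd_simp.
apply: eq_Rintegral => s; rewrite inE/= in_itv/= => /andP[as' st].
rewrite /RL_kernel subrr powRr0 mul1r cutE//.
by rewrite in_itv/= as' (le_trans (ltW st)).
Qed.

Lemma is_derive_RL_int1 (F : R -> R) t : C_weighted a b g F -> t \in `]a, b[ ->
  is_derive t 1 (RL_int a 1 F) (F t).
Proof.
move=> CF tab; have /andP[at' tb] : a < t < b by rewrite in_itv/= in tab.
have cF := continuous_cut (C_weighted_continuous CF) tab.
have [dI dE] := @continuous_FTC1 R (cut F) (BRight a) t b tb (integrable_cut CF) at' cF.
apply: (@near_eq_is_derive _ _ _ (fun t => \int[lebesgue_measure]_(s in `]a, t]) (cut F s))).
- near=> s; rewrite RL_int1E//; apply: subset_itv_oo_oc.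
  by near: s; exact: (near_in_itvoo tab).
- apply: DeriveDef; first exact: dI.
  by rewrite -derive1E dE cutE//; exact: subset_itv_oo_oc.
Unshelve. all: by end_near. Qed.

Lemma RL_int1_eq0 (F : R -> R) : C_weighted a b g F ->
  (forall t, t \in `]a, b] -> RL_int a 1 F t = 0) ->
  forall t, t \in `]a, b] -> F t = 0.
Proof.
move=> CF I0.
have F0 t : t \in `]a, b[ -> F t = 0.
  move=> tab; have dI := is_derive_RL_int1 CF tab.
  have d0 : is_derive t 1 (RL_int a 1 F) 0.
    apply: (@near_eq_is_derive _ _ _ (cst 0)).
    near=> s; rewrite I0//; apply: subset_itv_oo_oc.
    by near: s; exact: (near_in_itvoo tab).
  by rewrite -(@derive_val _ _ _ _ _ _ _ dI) derive_val.
move=> t; rewrite in_itv/= => /andP[at' tb].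
have [tb'|bt] := ltP t b; first by apply: F0; rewrite in_itv/= at'.
have {bt tb} -> : t = b by apply/eqP; rewrite eq_le tb bt.
have cl := within_cvg_at_left ab (C_weighted_continuous CF).
have cl0 : F s @[s --> b^'-] --> (0 : R).
  apply: cvg_near_cst; near=> s; apply: F0; rewrite in_itv/=.
  by apply/andP; split; near: s; [exact: nbhs_left_gt|exact: nbhs_left_lt].
exact: (cvg_unique _ cl cl0).
Unshelve. all: by end_near. Qed.

(** The derivative may be unbounded at a, so there is no direct integration from a. Instead G - I^1
    G' has derivative 0, hence is constant on (a, b], and its limit at a is 0. *)
Lemma RL_int1_ddt (G : R -> R) :
  (forall t, t \in `]a, b] -> differentiable_at a b G t) ->
  C_weighted a b g (ddt a b G) -> G t @[t --> a^'+] --> 0 ->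
  forall t, t \in `]a, b] -> RL_int a 1 (ddt a b G) t = G t.
Proof.
move=> dG CD G0.
have o01 : 0 < (1 : R) <= 1 by lra.
pose E t := G t - RL_int a 1 (ddt a b G) t.
have cI : {within `]a, b], continuous (RL_int a 1 (ddt a b G))}.
  apply: (@C_weighted_continuous R a b g); apply: C_weighted_RL_int => //.
  by rewrite ler01 lexx.
have cG := differentiable_at_continuous dG.
have cE : {within `]a, b], continuous E}.
  by move=> t; apply: cvgB; [exact: cG|exact: cI].
have dE t : t \in `]a, b[ -> is_derive t 1 E 0.
  move=> tab; rewrite -(subrr (ddt a b G t)); apply: is_deriveB.
    by apply: is_derive_ddt => //; apply: dG; exact: subset_itv_oo_oc.
  exact: is_derive_RL_int1.
have EE := derive0_constant cE dE.
have I0 : RL_int a 1 (ddt a b G) t @[t --> a^'+] --> (0 : R).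
  have [M M0 wD] := C_weighted_wbounded ab CD.
  have := rl_conv_cvg_right o01 g01 _ wD.
  rewrite ltrDl; case/andP: (g01) => -> _ /(_ isT) c.
  apply: cvg_trans c; apply: near_eq_cvg; near=> t.
  by rewrite (@RL_intE R a b)// ?Gamma1 ?invr1 ?mul1r//; near: t; exact: nbhs_right_le.
have E0 : E t @[t --> a^'+] --> (0 : R).
  by rewrite -(subrr (0 : R)); apply: cvgB.
move=> y; rewrite in_itv/= => /andP[ay yb].
have Ey : E t @[t --> a^'+] --> E y.
  apply: cvg_near_cst; near=> x.
  have ax : a < x by near: x; exact: nbhs_right_gt.
  have xy : x < y by near: x; exact: nbhs_right_lt.
  exact: EE.
have : E y = 0 by exact: (cvg_unique _ Ey E0).
by move=> /eqP; rewrite subr_eq0 => /eqP.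
Unshelve. all: by end_near. Qed.

(** Injectivity of I^1 reduces the claim to I^1 I^m D = I^1 F. Writing I^1 as I^m I^(1 - m) avoids
    the total order 1 + m, because I^(1 - m) I^m D = I^1 D = I^(1 - m) F. The last equality needs
    I^(1 - m) F to vanish at a, which is where m < g enters. *)
Lemma RL_int_RL_deriv (F : R -> R) m : 0 <= m < g -> C_RL a b g m F ->
  forall t, t \in `]a, b] -> RL_int a m (RL_deriv a b m F) t = F t.
Proof.
move=> /andP[m0 mg] [CF dF CD].
have /andP[g0 g1] := g01.
have m1 : m < 1 by lra.
have m01' : 0 < 1 - m <= 1 by lra.
have m01 : 0 <= m <= 1 by lra.
have o01 : 0 <= (1 : R) <= 1 by lra.
set D := RL_deriv a b m F in CD *.
have [M M0 wF] := C_weighted_wbounded ab CF.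
have G0 : RL_int a (1 - m) F t @[t --> a^'+] --> 0.
  have mg1 : 1 < 1 - m + g by lra.
  have c := rl_conv_cvg_right m01' g01 mg1 wF.
  have {}c : (Gamma (1 - m))^-1 * rl_conv (1 - m) (cut F) t @[t --> a^'+] --> (0 : R).
    by rewrite -(mulr0 (Gamma (1 - m))^-1); exact: cvgMr.
  apply: cvg_trans c; apply: near_eq_cvg; near=> t.
  by rewrite (@RL_intE R a b)//; [lra|near: t; exact: nbhs_right_le].
have I1 t : t \in `]a, b] -> RL_int a 1 D t = RL_int a (1 - m) F t.
  by move=> tab; exact: RL_int1_ddt.
have CI : C_weighted a b g (RL_int a m D) by exact: C_weighted_RL_int.
have CN : C_weighted a b g (fun s => -1 * RL_int a m D s).
  have [h [ch hI]] := CI; exists (fun t => -1 * h t); split.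
    by move=> t; apply: cvgMr; exact: ch.
  by move=> t tab; rewrite hI// mulrCA.
have CE := C_weightedD CF CN.
suff H0 t : t \in `]a, b] -> RL_int a 1 (fun s => F s + -1 * RL_int a m D s) t = 0.
  move=> t tab; have := RL_int1_eq0 CE H0 tab.
  by rewrite mulN1r => /eqP; rewrite subr_eq0 => /eqP.
move=> tab; have /andP[at' tb] : a < t <= b by rewrite in_itv/= in tab.
have o01' : 0 < (1 : R) <= 1 by lra.
rewrite (RL_intD ab g01 CF CN o01' tb) (RL_intZ ab g01 _ CI o01' tb).
suff -> : RL_int a 1 (RL_int a m D) t = RL_int a 1 F t by rewrite mulN1r subrr.
have [mz|mn0] := eqVneq m 0.
  transitivity (RL_int a 1 D t); first by rewrite /RL_int mz eqxx.
  by rewrite (I1 t tab) mz subr0.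
have mp : 0 < m by rewrite lt_neqAle eq_sym mn0.
have m0' : 0 < 1 - m by lra.
have mm : m + (1 - m) = 1 by ring.
have mm' : 1 - m + m = 1 by ring.
have mm1 : m + (1 - m) <= 1 by rewrite mm.
have mm1' : 1 - m + m <= 1 by rewrite mm'.
have SF := RL_int_semigroup ab g01 CF mp m0' mm1 tb.
have SI := RL_int_semigroup ab g01 CI mp m0' mm1 tb.
rewrite mm in SF SI; rewrite -SF -SI.
have E s : s \in `]a, b] ->
    RL_int a (1 - m) (RL_int a m D) s = RL_int a (1 - m) F s.
  move=> sab; have sb : s <= b by move: sab; rewrite in_itv/= => /andP[].
  have SD := RL_int_semigroup ab g01 CD m0' mp mm1' sb.
  by rewrite SD mm'; exact: I1.
exact: (@eq_RL_int R a b _ _ m t tab E).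
Unshelve. all: by end_near. Qed.

End fundamental_theorem.

(** * Continuity forced by superposition *)

(** Given e, all but finitely many [h n] lie between 0 and e everywhere, and the remaining ones vary
    by at most e on a common neighbourhood of x. *)
Lemma sup_range_continuous (R : realType) (h : nat -> R -> R) (d : nat -> R) :
  (forall n, continuous (h n)) -> (forall n x, 0 <= h n x <= d n) ->
  d n @[n --> \oo] --> 0 ->
  continuous (fun x => sup (range (h ^~ x))).
Proof.
move=> ch hd d0 x; set T := fun x => _.
have [B dB] : exists B, forall n, d n <= B.
  have /cvg_seq_bounded/pinfty_ex_gt0[B B0 dB] : cvg (d n @[n --> \oo]).
    by apply/cvg_ex; exists 0.
  by exists B => n; apply: le_trans (ler_norm _) _; exact: dB.
have ub y : has_ubound (range (h ^~ y)).
  exists B => _ [n _ <-]; apply: le_trans (dB n).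
  by have /andP[] := hd n y.
have hT n y : h n y <= T y by apply: ub_le_sup => //; exists n.
have T0 y : 0 <= T y.
  by apply: le_trans (hT O y); have /andP[] := hd O y.
have leT y v : (forall n, h n y <= v) -> T y <= v.
  by move=> hv; apply: ge_sup; [exists (h O y); exists O | move=> _ [n _ <-]].
apply/cvgrPdist_le => e e0.
have [N _ dN] : \forall n \near \oo, d n <= e by apply: (cvgr_le _ d0).
near=> y.
have hy (n : 'I_N) : `|h n x - h n y| <= e.
  by move: n; near: y; apply: filter_forall => n;
    have /cvgrPdist_le := ch n x; apply.
have hn n : `|h n x - h n y| <= e \/ d n <= e.
  by have [nN|Nn] := ltnP n N; [left; exact: (hy (Ordinal nN))|right; exact: dN].
rewrite ler_norml; apply/andP; split.
  rewrite lerBrDr addrC lerBlDr; apply: leT => n.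
  have [|dne] := hn n.
    rewrite ler_norml => /andP[H _]; have := hT n x; move: H; lra.
  have /andP[_ H] := hd n y; have := T0 x; move: H dne; lra.
rewrite lerBlDr; apply: leT => n.
have [|dne] := hn n.
  rewrite ler_norml => /andP[_ H]; have := hT n y; move: H; lra.
have /andP[_ H] := hd n x; have := T0 y; move: H dne; lra.
Unshelve. all: by end_near. Qed.

(* If [f s] jumps along [y_j -> z+], a continuous curve through [(s, z)] that
   rises so steeply that it takes each value [y_j] before [f _ y_j] has moved
   far from [f s y_j] contradicts the continuity of [t |-> f t (zeta t)]. *)
Lemma superposition_right_continuous (R : realType) (f : R -> R -> R) (a b s z : R) :
  s \in `]a, b] ->
  (forall zeta : R -> R, continuous zeta ->
    {within `]a, b], continuous (fun t => f t (zeta t))}) ->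
  f s y @[y --> z^'+] --> f s z.
Proof.
move=> sab fc; have /andP[as' sb] : a < s <= b by rewrite in_itv/= in sab.
have cf (zeta : R -> R) : continuous zeta -> forall e : R, 0 < e ->
    exists2 r : R, 0 < r &
    forall t, t \in `]a, b] -> `|s - t| < r -> `|f s (zeta s) - f t (zeta t)| < e.
  move=> czeta e e0; have /subspace_continuousP/(_ s sab) := fc _ czeta.
  move/cvgrPdist_lt => /(_ _ e0); rewrite near_withinE => /nbhs_ballP[r /= r0 H].
  by exists r => // t tab st; apply: H.
apply/cvgrPdist_lt => e e0; apply: contrapT => nn.
have /choice[y yP] (j : nat) : exists y : R, (z < y /\ y < z + j.+1%:R^-1) /\
    e <= `|f s z - f s y|.
  apply: contrapT => nex; apply: nn; near=> y.
  rewrite ltNge; apply/negP => h; apply: nex; exists y; split => //; split.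
    by near: y; exact: nbhs_right_gt.
  by near: y; apply: nbhs_right_lt; rewrite ltrDl invr_gt0.
have e20 : 0 < e / 2 by rewrite divr_gt0.
(* The constant curve y_j shows that f(t, y_j) stays within e / 2 of f(s, y_j) as long as |s - t| <=
   r_j; the bound 1 / (j + 1) drives these times to s. *)
have /choice[r rP] (j : nat) : exists r : R, (0 < r /\ r <= j.+1%:R^-1) /\
    forall t, t \in `]a, b] -> `|s - t| <= r -> `|f s (y j) - f t (y j)| < e / 2.
  have [r0 r00 H] := cf _ (@cst_continuous _ _ (y j)) _ e20.
  have j0 : 0 < j.+1%:R^-1 :> R by rewrite invr_gt0.
  exists (Num.min (r0 / 2) j.+1%:R^-1); split; first split.
  - by rewrite lt_min j0 andbT divr_gt0.
  - by rewrite ge_min lexx orbT.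
  - move=> t tab str; apply: H => //; apply: le_lt_trans str _.
    by rewrite gt_min; apply/orP; left; lra.
pose d (j : nat) : R := y j - z.
pose h (j : nat) (x : R) : R := Num.min (d j / r j * `|x|) (d j).
have d0 j : 0 < d j by rewrite subr_gt0; have [[]] := yP j.
have r0 j : 0 < r j by have [[]] := rP j.
have inv0 : (j.+1%:R^-1 : R) @[j --> \oo] --> (0 : R) by exact: cvg_harmonic.
have dcvg : d j @[j --> \oo] --> (0 : R).
  apply: (squeeze_cvgr _ (cvg_cst 0) inv0); apply: nearW => j.
  rewrite (ltW (d0 j)) lerBlDr addrC ltW//.
  by have [[]] := yP j.
have ch n : continuous (h n).
  move=> x; have c1 : {for x, continuous (fun x : R => d n / r n * `|x|)}.
    by apply: cvgMr; exact: norm_continuous.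
  exact: (@continuous_min R R _ (fun=> d n) x c1 (@cst_continuous _ _ (d n) x)).
have hd n x : 0 <= h n x <= d n.
  rewrite /h le_min (ltW (d0 n)) andbT ge_min lexx orbT andbT.
  by rewrite mulr_ge0// divr_ge0// ltW.
have cT := sup_range_continuous ch hd dcvg.
set T := fun x => _ in cT.
have T0 : T 0 = 0.
  have R0 : range (h ^~ 0) = [set 0].
    apply/seteqP; split => [_ [n _ <-]|_ ->].
      by rewrite /h normr0 mulr0 min_l// ltW.
    by exists O => //; rewrite /h normr0 mulr0 min_l// ltW.
  by change (sup (range (h ^~ 0)) = 0); rewrite R0 sup1.
have Tr n : d n <= T (r n).
  have hub : has_ubound (range (h ^~ (r n))).
    exists 1 => _ [j _ <-]; have /andP[_ H] := hd j (r n); apply: le_trans H _.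
    have [[_ H] _] := yP j; rewrite lerBlDr addrC ltW// (lt_le_trans H)// lerD2l.
    by rewrite invf_le1// ler1n.
  apply: ub_le_sup => //; exists n => //.
  by rewrite /h gtr0_norm// divfK ?gt_eqF// minxx.
pose zeta (t : R) : R := z + T (s - t).
have czeta : continuous zeta.
  move=> t; apply: cvgD; first exact: cvg_cst.
  apply: (@continuous_comp _ _ _ (fun t => s - t) T); last exact: cT.
  by apply: continuousB; [exact: cst_continuous|].
have [rho rho0 H] := cf _ czeta _ e20.
have zs : zeta s = z by rewrite /zeta subrr T0 addr0.
have m0 : 0 < Num.min rho (s - a) by rewrite lt_min rho0 subr_gt0.
have [n nm] : exists n : nat, n.+1%:R^-1 < Num.min rho (s - a).
  have [N _ HN] : \forall n \near \oo, (n.+1%:R^-1 : R) < Num.min rho (s - a).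
    by apply: (cvgr_lt _ inv0).
  by exists N; apply: HN => /=.
(* The curve thus takes the value y_n at time s - x with x <= r_n. Going back in time keeps it in
   (a, b] even when s = b. *)
have [x xr Tx] : exists2 x, x \in `[0, r n] & T x = d n.
  apply: IVT; first exact: ltW.
    exact: continuous_subspaceT.
  by rewrite T0 ge_min (ltW (d0 n)) le_max Tr orbT.
have /andP[x0 xrn] : 0 <= x <= r n by rewrite in_itv/= in xr.
have [[_ rn] Hn] := rP n.
have xm : x < Num.min rho (s - a) := le_lt_trans (le_trans xrn rn) nm.
have /andP[xrho xsa] : (x < rho) && (x < s - a) by rewrite lt_min in xm.
have tab : s - x \in `]a, b] by rewrite in_itv/=; lra.
have sx : `|s - (s - x)| = x by rewrite opprB addrCA subrr addr0 ger0_norm.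
have H1 := Hn _ tab; rewrite sx in H1; have {}H1 := H1 xrn.
have H2 := H _ tab; rewrite sx zs in H2; have {H2} := H2 xrho.
have -> : zeta (s - x) = y n.
  by rewrite /zeta opprB addrCA subrr addr0 Tx /d addrCA subrr addr0.
have [_ H3] := yP n => H2.
have := ler_normD (f s z - f (s - x) (y n)) (f (s - x) (y n) - f s (y n)).
rewrite addrA subrK (distrC (f (s - x) _)) => H4.
by move: H1 H2 H3 H4; lra.
Unshelve. all: by end_near. Qed.

Lemma superposition_continuous (R : realType) (f : R -> R -> R) (a b s : R) :
  s \in `]a, b] ->
  (forall zeta : R -> R, continuous zeta ->
    {within `]a, b], continuous (fun t => f t (zeta t))}) ->
  continuous (f s).
Proof.
move=> sab fc z; apply/left_right_continuousP; split; last first.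
  exact: superposition_right_continuous fc.
apply/cvg_at_leftNP.
have := @superposition_right_continuous R (fun t y => f t (- y)) a b s (- z) sab.
rewrite opprK; apply => zeta czeta; apply: (fc (fun t => - zeta t)).
by move=> t; apply: continuousN; exact: czeta.
Qed.

(** * The delayed equation and its limit *)

Lemma ultra_bounded_cvg (R : realType) (U : set_system nat) (x : nat -> R) (B : R) :
  UltraFilter U -> (forall n, `|x n| <= B) -> exists l : R, x n @[n --> U] --> l.
Proof.
move=> UU xB; have cB : compact `[- B, B] by exact: segment_compact.
have [|l [_ clu]] := cB (x @ U) _.
  change (U (x @^-1` `[- B, B]%classic)); apply: filterE => n.
  by rewrite /= in_itv/= -ler_norml.
exists l => V nV; have [//|nUV] := in_ultra_setVsetC (x @^-1` V) UU.
by have [y [nVy Vy]] := clu (~` V) V nUV nV.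
Qed.

(** The method of steps: S looks at its argument only before t - dl, so each iteration settles a
    further stretch of length dl. *)
Lemma iter_delay_stable (R : realType) (a dl : R) (S : (R -> R) -> R -> R) (w0 : R -> R) :
  (forall t : R, t <= a -> S w0 t = w0 t) ->
  (forall (w w' : R -> R) (t : R), (forall s, s < t - dl -> w s = w' s) -> S w t = S w' t) ->
  forall j (t : R), t <= a + j%:R * dl -> iter j.+1 S w0 t = iter j S w0 t.
Proof.
move=> S0 Sloc; elim=> [|j IH] t; first by rewrite mul0r addr0; exact: S0.
rewrite -natr1 mulrDl mul1r => ht; change (S (iter j.+1 S w0) t = S (iter j S w0) t).
by apply: Sloc => s st; apply: IH; lra.
Qed.

Lemma cvg_le_harmonic (R : realType) (x : nat -> R) (l : R) :
  (forall k, `|x k - l| <= k.+1%:R^-1) -> x k @[k --> \oo] --> l.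
Proof.
move=> H; apply/cvgrPdist_le => e e0; near=> k.
rewrite distrC; apply: le_trans (H k) _; near: k.
by apply: (cvgr_le _ (@cvg_harmonic R)).
Unshelve. all: by end_near. Qed.

(** In the application x, x0, xd are G_n at t, t0 and the delayed time, y and y0 are G at t and t0,
    and k, k0 are K_n and K. The second bound adds four errors, hence the quarters. *)
Lemma quarter_triangle (F : realFieldType) (x x0 xd y y0 k k0 e : F) :
  `|x - x0| <= e / 4 -> `|xd - x0| <= e / 4 -> `|x0 - y0| <= e / 4 ->
  `|y - y0| <= e / 4 -> `|k - k0| <= e / 4 ->
  `|x - y| <= e /\ `|k + xd - (k0 + y)| <= e.
Proof. by rewrite !ler_norml => *; lra. Qed.

Section delay.
Variables (R : realType) (a b g al m' M p q e' : R) (Phi : (R -> R) -> R -> R).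
Hypotheses (g01 : 0 < g <= 1) (al01 : 0 < al <= 1) (m01 : 0 < m' <= 1).
Hypotheses (M0 : 0 <= M).
(* [Phi w] is to be [t |-> f t ((t - a)^(g - 1) w t)], cut off outside [(a, b]];
   [p] below stands for [1 / Gamma al]. *)
Hypothesis Phi_bounded : forall w : R -> R, continuous w -> wbounded a g M (Phi w).
Hypothesis Phi_cvg : forall (w_ : nat -> R -> R) (w : R -> R),
  (forall s, s \in `]a, b] -> w_ n s @[n --> \oo] --> w s) ->
  forall s, Phi (w_ n) s @[n --> \oo] --> Phi w s.
Hypothesis Phi_local : forall w w' s, w s = w' s -> Phi w s = Phi w' s.

(** With p = 1 / Gamma(al) this is (t - a)^(1 - g) I^al phi(t) for t > a. It is 0 for t <= a, so the
    delayed equation starts with the constant K. *)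
Definition wint (phi : R -> R) (t : R) : R :=
  p * (ker (2 - g) (t - a) * rl_conv al phi t).

Lemma wint_continuous phi : wbounded a g M phi -> continuous (wint phi).
Proof.
by move=> wphi t; apply: cvgMr; exact: (wrl_conv_continuous al01 g01 M0 wphi).
Qed.

Lemma wint_equicont t0 e : 0 < e -> \forall t \near t0,
  forall phi, wbounded a g M phi -> `|wint phi t - wint phi t0| <= e.
Proof.
move=> e0; have p0 : 0 < `|p| + 1 by rewrite ltr_wpDl.
have ep : 0 < e / (`|p| + 1) by rewrite divr_gt0.
near=> t => phi wphi; rewrite /wint -mulrBr normrM.
have H : `|ker (2 - g) (t - a) * rl_conv al phi t -
    ker (2 - g) (t0 - a) * rl_conv al phi t0| <= e / (`|p| + 1).
  move: phi wphi; near: t; exact: wrl_conv_equicont.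
have -> : e = (`|p| + 1) * (e / (`|p| + 1)) by rewrite mulrC divfK// gt_eqF.
by apply: ler_pM => //; rewrite lerDl.
Unshelve. all: by end_near. Qed.

Lemma wint_cvg (phi_ : nat -> R -> R) phi t : (forall n, wbounded a g M (phi_ n)) ->
  (forall s, phi_ n s @[n --> \oo] --> phi s) ->
  wint (phi_ n) t @[n --> \oo] --> wint phi t.
Proof.
move=> wphi cphi; apply: cvgMr; apply: cvgMr.
exact: (rl_conv_cvg al01 g01 wphi cphi).
Qed.

Lemma wint_le phi t : t <= a -> wint phi t = 0.
Proof. by move=> ta; rewrite /wint ker_npos ?mul0r ?mulr0// subr_le0. Qed.

Lemma wint_bound t : exists B, forall phi, wbounded a g M phi -> `|wint phi t| <= B.
Proof.
exists (`|p| * (ker (2 - g) (t - a) * (M * (fine (eBeta al g) * ker (al + g) (t - a))))).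
move=> phi wphi; rewrite /wint !normrM ler_wpM2l// (ger0_norm (ker_ge0 _ _)).
by rewrite ler_wpM2l ?ker_ge0//; exact: rl_conv_bound.
Qed.

Lemma wint_local phi psi t : (forall s, s < t -> phi s = psi s) ->
  wint phi t = wint psi t.
Proof. by move=> H; rewrite /wint (rl_conv_local _ H). Qed.

Definition delay_step (dl K : R) (w : R -> R) (t : R) : R :=
  K + wint (Phi w) (t - dl).

Lemma delay_step_continuous dl K w : continuous w -> continuous (delay_step dl K w).
Proof.
move=> cw t; apply: cvgD; first exact: cvg_cst.
apply: (@continuous_comp _ _ _ (fun t => t - dl)).
  by apply: continuousB => //; exact: cst_continuous.
by apply: wint_continuous; exact: Phi_bounded.
Qed.

Definition delay_iter (dl K : R) (j : nat) : R -> R := iter j (delay_step dl K) (fun=> K).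

Lemma delay_iter_continuous dl K j : continuous (delay_iter dl K j).
Proof.
elim: j => [|j IH]; first exact: cst_continuous.
exact: delay_step_continuous.
Qed.

Lemma delay_iter_cvg dl (K_ : nat -> R) K j t : K_ n @[n --> \oo] --> K ->
  delay_iter dl (K_ n) j t @[n --> \oo] --> delay_iter dl K j t.
Proof.
move=> cK; elim: j t => [|j IH] t; first exact: cK.
apply: cvgD => //; apply: wint_cvg.
  by move=> n; apply: Phi_bounded; exact: delay_iter_continuous.
by apply: Phi_cvg => s _; exact: IH.
Qed.

(** The number of iterations needed to pass b does not depend on K, so one iterate serves all K and
    its continuity in K is that of the solution. *)
Lemma delay_fixpoint (dl : R) : 0 < dl -> exists j, forall K t : R, t <= b ->
  delay_iter dl K j t = K + wint (Phi (delay_iter dl K j)) (t - dl).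
Proof.
move=> dl0; have [j hj] : exists j : nat, (b - a) / dl <= j%:R.
  by exists (Num.truncn ((b - a) / dl)).+1; rewrite ltW// truncnS_gt.
exists j => K t tb; apply: esym.
have h1 s : s <= a -> delay_step dl K (fun=> K) s = K.
  by move=> sa; rewrite /delay_step wint_le ?addr0//; lra.
have h2 (w w' : R -> R) s : (forall r, r < s - dl -> w r = w' r) ->
    delay_step dl K w s = delay_step dl K w' s.
  move=> H; rewrite /delay_step; congr (_ + _); apply: wint_local => r rs.
  by apply: Phi_local; exact: H.
apply: (iter_delay_stable h1 h2 (j := j)).
by apply: (le_trans tb); rewrite -lerBlDl -ler_pdivrMr.
Qed.

(** The boundary condition divided by (c + d) Gamma(gamma) reads [K + functional w = e'], with m' =
    1 - mu and with 1 / Gamma(1 - mu) absorbed in q. *)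
Definition functional (w : R -> R) : R := q * rl_conv m' (Phi w) b.

Lemma functional_bound : exists2 C : R, 0 <= C &
  forall w : R -> R, continuous w -> `|functional w| <= C.
Proof.
exists (`|q| * (M * (fine (eBeta m' g) * ker (m' + g) (b - a)))).
  by rewrite !mulr_ge0 ?ker_ge0 ?fine_ge0 ?eBeta_ge0.
move=> w cw; rewrite normrM ler_wpM2l//; apply: rl_conv_bound => //.
exact: Phi_bounded.
Qed.

Lemma functional_cvg (w_ : nat -> R -> R) w :
  (forall n, continuous (w_ n)) ->
  (forall s, s \in `]a, b] -> w_ n s @[n --> \oo] --> w s) ->
  functional (w_ n) @[n --> \oo] --> functional w.
Proof.
move=> cw ww; apply: cvgMr; apply: (rl_conv_cvg m01 g01).
  by move=> n; exact: Phi_bounded.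
exact: Phi_cvg.
Qed.

(** If C bounds [functional], then K + functional w lies on opposite sides of e' for K = |e'| + C
    and its negative, whatever the delay; so L = |e'| + C is chosen before [dl]. *)
Lemma delay_solution : exists L : R, forall dl : R, 0 < dl ->
  exists (K : R) (w : R -> R),
  [/\ `|K| <= L, continuous w,
      forall t, t <= b -> w t = K + wint (Phi w) (t - dl) &
      K + functional w = e'].
Proof.
have [C C0 hC] := functional_bound; exists (`|e'| + C) => dl dl0.
have [j hj] := delay_fixpoint dl0.
pose Psi K := K + functional (delay_iter dl K j).
have cPsi : continuous Psi.
  move=> K; apply/continuous_withinNx/cvgr_dnbhsP => K_ [_ cK]; apply: cvgD => //.
  apply: functional_cvg => [n|s _]; first exact: delay_iter_continuous.
  exact: delay_iter_cvg.
have L0 : 0 <= `|e'| + C by rewrite addr_ge0.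
have hPsi K : `|functional (delay_iter dl K j)| <= C.
  by apply: hC; exact: delay_iter_continuous.
have [K KL PK] : exists2 K, K \in `[- (`|e'| + C), `|e'| + C] & Psi K = e'.
  apply: IVT; first lra.
    exact: continuous_subspaceT.
  have := hPsi (- (`|e'| + C)); rewrite ler_norml => /andP[_ H1].
  have := hPsi (`|e'| + C); rewrite ler_norml => /andP[H2 _].
  have := ler_norm e'; have := lerNnormlW (lexx `|e'|) => H3 H4.
  rewrite ge_min le_max; apply/andP; split; apply/orP; [left|right]; rewrite /Psi; lra.
exists K, (delay_iter dl K j); split => //.
- by rewrite ler_norml; move: KL; rewrite in_itv.
- exact: delay_iter_continuous.
- by move=> t tb; exact: hj.
Qed.

Lemma fixed_point_existence : exists (K : R) (w : R -> R), [/\ continuous w,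
  forall t, t \in `]a, b] -> w t = K + wint (Phi w) t & K + functional w = e'].
Proof.
have [L hL] := delay_solution.
have /choice[Kw hKw] (n : nat) : exists Kw : R * (R -> R),
  [/\ `|Kw.1| <= L, continuous Kw.2,
      forall t, t <= b -> Kw.2 t = Kw.1 + wint (Phi Kw.2) (t - n.+1%:R^-1) &
      Kw.1 + functional Kw.2 = e'].
  have n0 : 0 < n.+1%:R^-1 :> R by rewrite invr_gt0.
  by have [K [w H]] := hL _ n0; exists (K, w).
pose K_ n := (Kw n).1; pose w_ n := (Kw n).2.
have wPhi n : wbounded a g M (Phi (w_ n)) by apply: Phi_bounded; case: (hKw n).
pose G_ n := wint (Phi (w_ n)).
(* Along an ultrafilter K_n and all the G_n(t) converge at once, without a diagonal argument. *)
have [U [UU ooU]] := ultraFilterLemma (@eventually_filter : ProperFilter (\oo : set_system nat)).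
have [K cK] : exists l : R, K_ n @[n --> U] --> l.
  by apply: (@ultra_bounded_cvg R U K_ L) => n; case: (hKw n).
have /choice[G cG] (t : R) : exists l : R, G_ n t @[n --> U] --> l.
  have [B HB] := wint_bound t.
  by apply: (@ultra_bounded_cvg R U (G_ ^~ t) B) => n; exact: HB.
have GE (t0 e : R) : 0 < e -> \forall t \near t0, `|G t - G t0| <= e.
  move=> e0; near=> t.
  have H n : `|G_ n t - G_ n t0| <= e.
    by move: n; near: t; have := wint_equicont t0 e0;
      apply: filterS => t H n; exact: H.
  have c : `|G_ n t - G_ n t0| @[n --> U] --> `|G t - G t0|.
    by apply: cvg_norm; apply: cvgB; exact: cG.
  by apply: (ler_cvg_to c (@cvg_cst _ e _ U _)); exact: nearW.
have cGc : continuous G.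
  by move=> t0; apply/cvgrPdist_le => e /(GE t0); apply: filterS => t; rewrite distrC.
pose w t := K + G t.
(* Equicontinuity and compactness of [a, b] turn pointwise into uniform convergence. Half of the
   radius [rho] is reserved for the delay, so that t - 1 / (n + 1) is still close to t0. *)
have unif (e : R) : 0 < e -> \forall n \near U, forall t, t \in `[a, b] ->
    `|G_ n t - G t| <= e /\ `|w_ n t - w t| <= e.
  move=> e0; have e4 : 0 < e / 4 by rewrite divr_gt0.
  pose P n t := t <= b -> `|G_ n t - G t| <= e /\ `|w_ n t - w t| <= e.
  have /compact_near_coveringP/(_ nat U P _) := @segment_compact R a b.
  move=> H; have {H} : \near U, `[a, b]%classic `<=` P U.
    apply: H => t0 _; have /nbhs_ballP[rho /= rho0 Hrho] := wint_equicont t0 e4.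
    have rho20 : 0 < rho / 2 by rewrite divr_gt0.
    have nb : \forall n \near U, n.+1%:R^-1 < rho / 2.
      by apply: ooU; apply: (cvgr_lt _ (@cvg_harmonic R)).
    near=> t n; rewrite /P/= => tb.
    have t0t : `|t0 - t| < rho / 2.
      by near: t; exact: (nbhsx_ballx t0 _ rho20).
    have n0 : 0 < n.+1%:R^-1 :> R by rewrite invr_gt0.
    have nr : n.+1%:R^-1 < rho / 2 by near: n.
    have h1 : `|G_ n t - G_ n t0| <= e / 4.
      by apply: Hrho => //; rewrite /ball/=; lra.
    have h2 : `|G_ n (t - n.+1%:R^-1) - G_ n t0| <= e / 4.
      apply: Hrho => //; rewrite /ball/= opprB addrCA addrC.
      by apply: le_lt_trans (ler_normD _ _) _; rewrite (gtr0_norm n0) [ltRHS]splitr ltrD.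
    have h3 : `|G_ n t0 - G t0| <= e / 4.
      by rewrite distrC; near: n; move/cvgrPdist_le : (cG t0); apply.
    have h4 : `|G t - G t0| <= e / 4 by near: t; exact: GE.
    have h5 : `|K_ n - K| <= e / 4.
      by rewrite distrC; near: n; move/cvgrPdist_le : cK; apply.
    have [_ _ wE _] := hKw n; have {}wE : w_ n t = K_ n + G_ n (t - n.+1%:R^-1).
      exact: wE.
    have [q1 q2] := quarter_triangle h1 h2 h3 h4 h5.
    by split; [exact: q1|rewrite wE; exact: q2].
  apply: filterS => n H t tab; apply: (H t) => //.
  by move: tab; rewrite in_itv/= => /andP[].
have /choice[sg sgP] (k : nat) : exists n, (forall t, t \in `[a, b] ->
    `|G_ n t - G t| <= k.+1%:R^-1 /\ `|w_ n t - w t| <= k.+1%:R^-1) /\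
    `|K_ n - K| <= k.+1%:R^-1.
  have k0 : 0 < k.+1%:R^-1 :> R by rewrite invr_gt0.
  have hK : \forall n \near U, `|K_ n - K| <= k.+1%:R^-1.
    move/cvgrPdist_le : cK => /(_ _ k0); apply: filterS => n.
    by rewrite distrC.
  exact: (filter_ex (filterI (unif _ k0) hK)).
have wPhi' k : wbounded a g M (Phi (w_ (sg k))) by [].
have cw : continuous w.
  by move=> t; apply: cvgD; [exact: cvg_cst|exact: cGc].
have ws s : s \in `]a, b] -> w_ (sg k) s @[k --> \oo] --> w s.
  move=> sab; apply: cvg_le_harmonic => k; have [H _] := sgP k.
  by have [] := H s (subset_itv_oc_cc sab).
exists K, w; split => // [t tab|].
  congr (_ + _).
  have c1 : G_ (sg k) t @[k --> \oo] --> G t.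
    apply: cvg_le_harmonic => k; have [H _] := sgP k.
    by have [] := H t (subset_itv_oc_cc tab).
  have c2 := @wint_cvg _ _ t wPhi' (Phi_cvg ws).
  exact: (cvg_unique _ c1 c2).
have c1 : K_ (sg k) + functional (w_ (sg k)) @[k --> \oo] --> K + functional w.
  apply: cvgD; first by apply: cvg_le_harmonic => k; have [] := sgP k.
  by apply: functional_cvg => // k; case: (hKw (sg k)).
have c2 : K_ (sg k) + functional (w_ (sg k)) @[k --> \oo] --> e'.
  by apply: cvg_near_cst; apply: nearW => k; case: (hKw (sg k)).
exact: (cvg_unique _ c1 c2).
Unshelve. all: by end_near. Qed.

End delay.

(** * The boundary value problem *)

(** By the relation between the orders, D^(alpha, beta) is I^(beta (1 - alpha)) D^gamma, and
    fractional integration preserves weighted continuity. *)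
Lemma C_RL_sub_C_hilfer (R : realType) (a b alpha beta gamma : R) :
  a < b -> 0 < gamma <= 1 -> 0 <= beta * (1 - alpha) <= 1 ->
  (1 - beta) * (1 - alpha) = 1 - gamma ->
  C_RL a b gamma gamma `<=` C_hilfer a b gamma alpha beta.
Proof.
move=> ab g01 m01 E z [Cz dz CD]; split => //.
  move=> t tab; rewrite E; split; first exact: dz.
  apply: (C_weighted_RL_integrable ab g01 CD m01).
  by move: tab; rewrite in_itv/= => /andP[].
rewrite /hilfer_deriv E; exact: C_weighted_RL_int CD m01.
Qed.

Lemma ker_continuous_gt1 (R : realType) (p : R) : 1 < p -> continuous (@ker R p).
Proof.
move=> p1 x; have [x0|x0|->] := ltgtP x 0.
- rewrite /continuous_at (ker_npos _ (ltW x0)); apply: cvg_near_cst; near=> y.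
  by apply: ker_npos; apply: ltW; near: y; exact: lt_nbhsl.
- exact: ker_continuous.
- by rewrite /continuous_at ker_npos//; exact: ker_cvg0.
Unshelve. all: by end_near. Qed.

(** This admits every continuous curve in the hypothesis on [f], as the superposition argument
    requires. *)
Lemma continuous_C_weighted (R : realType) (a b g : R) (zeta : R -> R) :
  g <= 1 -> continuous zeta -> C_weighted a b g zeta.
Proof.
(* For g = 1 the weight [ker (2 - g)] would jump at a, so [zeta] itself is taken as the
   extension. *)
move=> g1 czeta; have [->|gN] := eqVneq g 1.
  exists zeta; split; first exact: continuous_subspaceT.
  by move=> t _; rewrite subrr powRr0 mul1r.
have g1' : g < 1 by rewrite lt_neqAle gN.
exists (fun t => ker (2 - g) (t - a) * zeta t); split.
  apply: continuous_subspaceT => t; apply: cvgM; last exact: czeta.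
  apply: (@continuous_comp _ _ _ (fun t => t - a)).
    by apply: continuousB => //; exact: cst_continuous.
  by apply: ker_continuous_gt1; lra.
move=> t; rewrite in_itv/= -subr_gt0 => /andP[ta _].
by rewrite ker_pos//; congr (_ `^ _ * _); ring.
Qed.

Section hilfer_problem.
Variables (R : realType) (a b alpha beta gamma : R).
Hypotheses (ab : a < b) (halpha : 0 < alpha < 1) (hbeta : 0 <= beta <= 1).
Hypothesis hgamma : gamma = alpha + beta - alpha * beta.

Let g01 : 0 < gamma <= 1.
Proof.
have /andP[a0 a1] := halpha; have /andP[b0 b1] := hbeta.
by rewrite hgamma; apply/andP; split; nra.
Qed.

(** The inequality is strict because the difference is exactly [alpha]. *)
Let m01 : 0 <= beta * (1 - alpha) < gamma.
Proof.
have /andP[a0 a1] := halpha; have /andP[b0 b1] := hbeta.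
by rewrite hgamma; apply/andP; split; nra.
Qed.

Let al01 : 0 < alpha <= 1.
Proof. by case/andP: halpha => -> /ltW ->. Qed.

Let E1 : (1 - beta) * (1 - alpha) = 1 - gamma.
Proof. by rewrite hgamma; ring. Qed.

Let E2 : 1 - gamma + alpha = 1 - beta * (1 - alpha).
Proof. by rewrite hgamma; ring. Qed.

(** I^(1 - gamma) sends (t - a)^(gamma - 1) to the constant B(1 - gamma, gamma) / Gamma(1 - gamma) =
    Gamma(gamma); the other term is the semigroup law. For gamma = 1 the integral of order 0 is the
    identity. *)
Lemma RL_int_solution (F : R -> R) (K t : R) : C_weighted a b gamma F ->
  t \in `]a, b] ->
  RL_int a (1 - gamma) (fun t => K * (t - a) `^ (gamma - 1) + RL_int a alpha F t) t =
  K * Gamma gamma + RL_int a (1 - beta * (1 - alpha)) F t.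
Proof.
move=> CF tab; have /andP[at' tb] : a < t <= b by rewrite in_itv/= in tab.
have /andP[g0 g1] := g01; have /andP[a0 a1] := halpha.
have [gE|gN] := eqVneq gamma 1.
  by rewrite -E2 gE subrr add0r {1}/RL_int eqxx powRr0 Gamma1 mulr1.
have m1 : 0 < 1 - gamma by rewrite subr_gt0 lt_neqAle gN.
have m1' : 0 < 1 - gamma <= 1 by lra.
have a01 : 0 <= alpha <= 1 by lra.
have CP := @C_weighted_pow R a b gamma.
have CI := C_weighted_RL_int ab g01 CF a01.
rewrite (RL_intD ab g01 (CP K) CI m1' tb).
have C1 : C_weighted a b gamma (fun s => (s - a) `^ (gamma - 1)).
  by apply: C_weighted_eq (CP 1) => s _; rewrite mul1r.
rewrite (RL_intZ ab g01 K C1 m1' tb) (RL_int_pow a gamma m1' tb) -E2.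
have s1 : 1 - gamma + alpha <= 1.
  by rewrite E2 lerBlDr lerDl; case/andP : m01.
rewrite (RL_int_semigroup ab g01 CF m1 a0 s1 tb).
congr (K * _ + _); have m1g : 1 - gamma + gamma = 1 by ring.
rewrite m1g ker1 ?subr_gt0// mulr1.
have := @Gamma_eBeta R _ _ m1 g0; rewrite m1g Gamma1 mulr1 lexx => /(_ isT) <-.
by rewrite mulKf// gt_eqF// Gamma_gt0.
Qed.

(** I^(1 - gamma) z tends to K Gamma(gamma) at a and to K Gamma(gamma) + I^(1 - mu) F(b) at b, so
    the equation assumed of K is the boundary condition. *)
Lemma hilfer_solution (F z : R -> R) (K c d e : R) :
  C_RL a b gamma (beta * (1 - alpha)) F -> C_weighted a b gamma z ->
  (forall t, t \in `]a, b] ->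
    z t = K * (t - a) `^ (gamma - 1) + RL_int a alpha F t) ->
  (c + d) * (K * Gamma gamma) + d * RL_int a (1 - beta * (1 - alpha)) F b = e ->
  [/\ C_RL a b gamma gamma z,
      forall t, t \in `]a, b] -> hilfer_deriv a b alpha beta z t = F t &
      boundary_condition a b gamma c d e z].
Proof.
move=> CRF Cz zE KE; have [CF dF CD] := CRF.
have /andP[m0 mg] := m01.
have /andP[g0 g1] := g01; have /andP[a0 a1] := halpha.
have Iz t : t \in `]a, b] -> RL_int a (1 - gamma) z t =
    K * Gamma gamma + RL_int a (1 - beta * (1 - alpha)) F t.
  by move=> tab; rewrite (eq_RL_int _ tab zE) RL_int_solution.
have Dz t : t \in `]a, b] ->
    RL_deriv a b gamma z t = RL_deriv a b (beta * (1 - alpha)) F t.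
  by move=> tab; exact: ddt_eq tab Iz.
have bab : b \in `]a, b] by rewrite in_itv/= ab lexx.
split.
- split; first exact: Cz.
    by move=> t tab; apply: (differentiable_at_eq tab Iz); exact: dF.
  by apply: C_weighted_eq CD => t tab; rewrite Dz.
- move=> t tab; rewrite /hilfer_deriv E1 (eq_RL_int _ tab Dz).
  exact: (RL_int_RL_deriv ab g01 m01 CRF).
exists (K * Gamma gamma), (K * Gamma gamma + RL_int a (1 - beta * (1 - alpha)) F b).
have m1 : 0 < 1 - beta * (1 - alpha) <= 1 by lra.
have m1' : 0 <= 1 - beta * (1 - alpha) <= 1 by lra.
split.
- have [M M0 wF] := C_weighted_wbounded ab CF.
  have mg1 : 1 < 1 - beta * (1 - alpha) + gamma by lra.
  have c0 := rl_conv_cvg_right m1 g01 mg1 wF.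
  have c1 : K * Gamma gamma + (Gamma (1 - beta * (1 - alpha)))^-1 *
      rl_conv (1 - beta * (1 - alpha)) (F \_ `]a, b]) t @[t --> a^'+] -->
      K * Gamma gamma + (Gamma (1 - beta * (1 - alpha)))^-1 * 0.
    by apply: cvgD; [exact: cvg_cst|exact: cvgMr].
  rewrite mulr0 addr0 in c1; apply: cvg_trans c1; apply: near_eq_cvg; near=> t.
  have at' : a < t by near: t; exact: nbhs_right_gt.
  have tb : t <= b by near: t; exact: nbhs_right_le.
  rewrite Iz ?in_itv/= ?at' ?tb//; congr (_ + _).
  by rewrite (@RL_intE R a b)//; case/andP : m1.
- have CI := C_weighted_RL_int ab g01 CF m1'.
  have c0 := within_cvg_at_left ab (C_weighted_continuous CI).
  have c1 : K * Gamma gamma + RL_int a (1 - beta * (1 - alpha)) F t @[t --> b^'-] -->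
      K * Gamma gamma + RL_int a (1 - beta * (1 - alpha)) F b.
    by apply: cvgD; [exact: cvg_cst|exact: c0].
  apply: cvg_trans c1; apply: near_eq_cvg; near=> t.
  rewrite Iz// in_itv/=; apply/andP; split; near: t.
    exact: nbhs_left_gt.
  exact: nbhs_left_le.
- by rewrite -KE; ring.
Unshelve. all: by end_near. Qed.

Lemma hilfer_fixed_point (f : R -> R -> R) (eta : R -> R) (q e' : R) :
  (forall z : R -> R, C_weighted a b gamma z ->
    C_weighted a b gamma (fun t => f t (z t))) ->
  C_weighted a b gamma eta ->
  (forall t z : R, t \in `]a, b] -> `|f t z| <= eta t) ->
  exists (K : R) (z : R -> R), [/\ C_weighted a b gamma z,
    forall t, t \in `]a, b] -> z t = K * (t - a) `^ (gamma - 1) +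
      RL_int a alpha (fun t => f t (z t)) t &
    K + q * RL_int a (1 - beta * (1 - alpha)) (fun t => f t (z t)) b = e'].
Proof.
move=> hf heta hfeta.
have /andP[m0 mg] := m01.
have /andP[g0 g1] := g01; have /andP[a0 a1] := halpha.
have m1 : 0 < 1 - beta * (1 - alpha) <= 1 by lra.
have [M M0 weta] := C_weighted_wbounded ab heta.
pose zz (w : R -> R) t := ker gamma (t - a) * w t.
pose Phi (w : R -> R) := (fun t => f t (zz w t)) \_ `]a, b].
have Czz (w : R -> R) : continuous w -> C_weighted a b gamma (zz w).
  move=> cw; exists w; split; first exact: continuous_subspaceT.
  move=> t; rewrite in_itv/= -subr_gt0 => /andP[ta _].
  by rewrite /zz mulrA weightK// mul1r.
have Phi_bounded (w : R -> R) : continuous w -> wbounded a gamma M (Phi w).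
  (* Only measurability is taken from here: the bound N depends on w, whereas the bound M coming
     from [eta] serves all w. *)
  move=> cw; have [N N0 [mPhi _]] := C_weighted_wbounded ab (hf _ (Czz w cw)).
  split => // s; have [sab|sab] := boolP (s \in `]a, b]).
    rewrite /Phi cutE//; apply: le_trans (hfeta _ _ sab) _.
    by have [_ /(_ s)] := weta; rewrite cutE//; apply: le_trans; exact: ler_norm.
  rewrite /Phi patchE ifF; first by rewrite normr0 mulr_ge0 ?ker_ge0.
  by apply/negP; rewrite inE; apply/negP.
have cf s : s \in `]a, b] -> continuous (f s).
  move=> sab; apply: (superposition_continuous sab) => zeta czeta.
  by apply: (@C_weighted_continuous R a b gamma); apply: hf; exact: continuous_C_weighted.
have Phi_cvg (w_ : nat -> R -> R) (w : R -> R) :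
    (forall s, s \in `]a, b] -> w_ n s @[n --> \oo] --> w s) ->
    forall s, Phi (w_ n) s @[n --> \oo] --> Phi w s.
  move=> ww s; have [sab|sab] := boolP (s \in `]a, b]).
    rewrite /Phi cutE//; under eq_fun do rewrite cutE//.
    by apply: continuous_cvg; [exact: cf|apply: cvgMr; exact: ww].
  have P0 (v : R -> R) : Phi v s = 0.
    by rewrite /Phi patchE ifF//; apply/negP; rewrite inE; apply/negP.
  by rewrite P0; under eq_fun do rewrite P0; exact: cvg_cst.
have Phi_local (w w' : R -> R) s : w s = w' s -> Phi w s = Phi w' s.
  by move=> ww; rewrite /Phi !patchE /zz ww.
have [K [w [cw wE KE]]] := @fixed_point_existence R a b gamma alpha
  (1 - beta * (1 - alpha)) M (Gamma alpha)^-1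
  (q * (Gamma (1 - beta * (1 - alpha)))^-1) e' Phi g01 al01 m1 M0
  Phi_bounded Phi_cvg Phi_local.
exists K, (zz w); split; first exact: Czz.
  move=> t tab; have /andP[at' tb] : a < t <= b by rewrite in_itv/= in tab.
  have ta : 0 < t - a by rewrite subr_gt0.
  rewrite {1}/zz wE// mulrDr mulrC -ker_pos//; congr (_ + _).
  rewrite (@RL_intE R a b)// /wint mulrCA; congr (_ * _).
  rewrite mulrA kerM (_ : gamma + (2 - gamma) - 1 = 1); last by ring.
  by rewrite ker1// mul1r.
rewrite -KE /functional (@RL_intE R a b)//; last by case/andP : m1.
by rewrite mulrA.
Qed.

End hilfer_problem.

Theorem theorem3p3 (R : realType) (a b alpha beta gamma c d e : R)
    (f : R -> R -> R) (eta : R -> R)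
    (hab : a < b)
    (halpha : 0 < alpha < 1)
    (hbeta : 0 <= beta <= 1)
    (hgamma : gamma = alpha + beta - alpha * beta)
    (hcd : c + d != 0)
    (hf : forall z : R -> R, C_weighted a b gamma z ->
      C_RL a b gamma (beta * (1 - alpha)) (fun t : R => f t (z t)))
    (heta : C_weighted a b gamma eta)
    (hfeta : forall t z : R, t \in `]a, b] -> `|f t z| <= eta t) :
  C_RL a b gamma gamma `<=` C_hilfer a b gamma alpha beta /\
  exists z : R -> R,
    [/\ C_RL a b gamma gamma z,
        forall t : R, t \in `]a, b] ->
          hilfer_deriv a b alpha beta z t = f t (z t) &
        boundary_condition a b gamma c d e z].
Proof.
have /andP[a0 a1] := halpha; have /andP[b0 b1] := hbeta.
have g01 : 0 < gamma <= 1 by rewrite hgamma; apply/andP; split; nra.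
split.
  apply: C_RL_sub_C_hilfer => //; first by apply/andP; split; nra.
  by rewrite hgamma; ring.
have Gg := Gamma_gt0 g01.
have hf' (z : R -> R) : C_weighted a b gamma z ->
  C_weighted a b gamma (fun t => f t (z t)) by case/hf.
(* The constants come from dividing the boundary condition by (c + d) Gamma(gamma), which is where
   [hcd] enters; with c = d = 0 and e nonzero no z could satisfy that condition. *)
have [K [z [Cz zE KE]]] := hilfer_fixed_point hab halpha hbeta hgamma
  (d / ((c + d) * Gamma gamma)) (e / ((c + d) * Gamma gamma)) hf' heta hfeta.
exists z; apply: (hilfer_solution hab halpha hbeta hgamma (hf z Cz) Cz zE).
move: KE; move: (RL_int _ _ _ _) (Gamma gamma) Gg => I G G0 KE.
rewrite -[RHS](@divfK _ ((c + d) * G)); last by rewrite mulf_neq0// gt_eqF.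
by rewrite -KE; field; rewrite hcd gt_eqF.
Qed.
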